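(* Consider problem (P) with $g(x)=\mathcal{B}x-B$. Let $x^*$ be a local optimal solution of (P), $v^*:=-\nabla\varphi(x^* )$ and $X^*:=g(x^* )$. Suppose that $\mathcal{G}$ is metrically regular at $(x^*,(0,0))$. Pick any $(y^*,S^* )\in\mathcal{M}(x^*,v^* )$, and let $\alpha^*,\beta^*,\gamma^*$, $\alpha_1,\ldots,\alpha_p$ and $\gamma_1,\ldots,\gamma_s$ be the index sets associated with $(X,S)=(X^*,S^* )$. Let $K^*:=\mathcal{T}_{\mathbb{S}^n_+}(X^* )\cap\mathrm{Sp}(\mathcal{N}_{\mathbb{S}^n_+}(-S^* ))$. Suppose that $\mathcal{B}\mathbb{X}\supset K^*$, that $\mathcal{B}$ is injective on the set $\mathcal{B}^{-1}(K^* )$, and that at least one of the following two conditions holds: (A) $\mathrm{Sp}(\mathcal{N}_{\mathbb{S}^n_+}(X^* ))\cap(\mathcal{B}^* )^{-1}(\mathrm{Im}\,\mathcal{A}^* )=\{0\}$; (B) $\mathcal{B}^*[\mathrm{Sp}(\mathcal{N}_{\mathbb{S}^n_+}(X^* ))]\subset\mathcal{A}^*\mathbb{R}^m$. If $x^*$ is a tilt-stable solution of (P), then $$\operatorname{Ker}\nabla^2\varphi(x^* )\cap\operatorname{Ker}\mathcal{A}\cap\widehat\Upsilon=\{0\},\quad\text{or equivalently}\quad \operatorname{Ker}\nabla^2\varphi(x^* )\cap\operatorname{Ker}\mathcal{A}\cap\widehat\Upsilon^*=\{0\},$$ where $\widehat\Upsilon$ is the set of all $w\in\mathbb{X}$ for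 which there exist index sets $\beta_-^*,\beta_+^*,\beta_0^*,\widetilde\gamma^*\subset[n]$ with $\gamma^*\subset\widetilde\gamma^*$, a matrix $P^*\in\mathbb{O}(X^* )\cap\mathbb{O}(S^* )$ and a block diagonal matrix $Q=\mathrm{BlkDiag}(Q_1,\ldots,Q_p)$ with $Q_j\in\mathbb{O}^{|\alpha_j|}$ and $Q_p=\mathrm{BlkDiag}(Q_p^1,\ldots,Q_p^s)$, $Q_p^1\in\mathbb{O}^{|\beta^*|}$, $Q_p^j\in\mathbb{O}^{|\gamma_j|}$ for $j\in\{2,\ldots,s\}$, such that $P^*Q\in\mathbb{O}(X^* )\cap\mathbb{O}(S^* )$ and, with $\widetilde W:=(P^*Q)^\top(\mathcal{B}w)P^*Q$, $$\beta^*=\beta_-^*\cup\beta_+^*\cup\beta_0^*\cup[\widetilde\gamma^*\setminus\gamma^*],\quad \widetilde W_{\beta_0^*\beta_0^*}\succeq 0,\quad \widetilde W_{[\beta_0^*\cup\beta_-^*\cup\widetilde\gamma^*][\beta_-^*\cup\widetilde\gamma^*]}=0,\quad \widetilde W_{[\alpha^*\cup\beta_+^*]\widetilde\gamma^*}=0;$$ and $$\widehat\Upsilon^*:=\big\{w\in\mathbb{X}:\ \exists\,R\in\mathbb{O}(X^* )\cap\mathbb{O}(S^* )\ \text{such that}\ [R_{\alpha^*}\ R_{\beta^*}\ R_{\gamma^*}]^\top(\mathcal{B}w)R_{\gamma^*}=0\big\}.$$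
   Context: $\mathbb{X}$ is a finite-dimensional real Euclidean space with inner product $\langle\cdot,\cdot\rangle$; $\mathbb{S}^n$ is the space of real symmetric $n\times n$ matrices with the trace inner product and Frobenius norm; $\mathbb{S}^n_+$ is the cone of positive semidefinite matrices; $\mathbb{O}^k$ is the set of $k\times k$ real orthogonal matrices; $[n]=\{1,\ldots,n\}$; $\mathbb{B}(x,\delta)$ is the closed ball. Problem (P): $\min_{x\in\mathbb{X}}\{\varphi(x):\ \mathcal{A}x=b,\ g(x)\in\mathbb{S}^n_+\}$ with $g(x)=\mathcal{B}x-B$, and feasible set $\Gamma:=\mathcal{A}^{-1}(b)\cap g^{-1}(\mathbb{S}^n_+)$. Here $\varphi:\mathbb{X}\to(-\infty,\infty]$ is proper, lower semicontinuous and twice continuously differentiable on an open set $\mathcal{O}\supset\Gamma$; $\mathcal{A}:\mathbb{X}\to\mathbb{R}^m$ and $\mathcal{B}:\mathbb{X}\to\mathbb{S}^n$ are linear, with adjoints $\mathcal{A}^*,\mathcal{B}^*$; $b\in\mathbb{R}^m$ and $B\in\mathbb{S}^n$. Tilt stability: for $f:\mathbb{X}\to(-\infty,\infty]$ proper, $\bar x\in\mathrm{dom}\,f$ is a tilt-stable local minimum of $f$ if there is $\delta>0$ such that $M_\delta(v):=\arg\min_{x\in\mathbb{B}(\bar x,\delta)}\{f(x)-f(\bar x)-\langle v,x-\bar x\rangle\}$ is single-valued and Lipschitz continuous on some neighborhood of $v=0$ with $M_\delta(0)=\{\bar x\}$. ''$x^*$ is a tilt-stable solution of (P)'' means that $x^*$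 is a tilt-stable local minimum of $\varphi+\delta_\Gamma$, $\delta_\Gamma$ the indicator function of $\Gamma$. Metric regularity: $\mathcal{F}:\mathbb{X}\rightrightarrows\mathbb{Z}$ is metrically regular at $(x,z)\in\mathrm{gph}\,\mathcal{F}$ if there are $\delta,\kappa>0$ with $\mathrm{dist}(x',\mathcal{F}^{-1}(z'))\le\kappa\,\mathrm{dist}(z',\mathcal{F}(x'))$ for all $(x',z')\in\mathbb{B}((x,z),\delta)$. The multifunction $\mathcal{G}:\mathbb{X}\rightrightarrows\mathbb{R}^m\times\mathbb{S}^n$ is $\mathcal{G}(z):=(\mathcal{A}z-b,\,g(z))-\{0\}^m\times\mathbb{S}^n_+$. $\mathcal{T}_\Omega$ and $\mathcal{N}_\Omega$ are the tangent and normal cones of convex analysis ($\mathcal{N}_\Omega(x)=\{v:\langle v,x'-x\rangle\le0\ \forall x'\in\Omega\}$). For a closed convex cone $K$, $\mathrm{Sp}(K):=\mathbb{R}_+(K-K)$ is the linear space generated by $K$. Multipliers: $\mathcal{M}(x,v):=\{(y,S)\in\mathbb{R}^m\times\mathcal{N}_{\mathbb{S}^n_+}(g(x)):\mathcal{A}^*y+\mathcal{B}^*S=v\}$ if $v\in\mathcal{N}_\Gamma(x)$, and $\mathcal{M}(x,v):=\emptyset$ otherwise. Spectral notation: $\lambda_1(X)\ge\cdots\ge\lambda_n(X)$ are the eigenvalues of $X\in\mathbb{S}^n$, $\lambda(X)=(\lambda_1(X),\ldots,\lambda_n(X))^\top$, $\mathbb{O}(X):=\{P\in\mathbb{O}^n: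 X=P\,\mathrm{Diag}(\lambda(X))P^\top\}$. For $X\in\mathbb{S}^n_+$, $S\in\mathcal{N}_{\mathbb{S}^n_+}(X)$, the distinct eigenvalues of $X$ and $S$ are denoted $\mu_1>\cdots>\mu_p=0$ and $0=\nu_1>\nu_2>\cdots>\nu_s$ (the class for the eigenvalue $0$ being empty if the matrix is nonsingular), and $\alpha_j:=\{i\in[n]:\lambda_i(X)=\mu_j\}$ for $j\in[p]$, $\gamma_j:=\{i\in[n]:\lambda_i(S)=\nu_j\}$ for $j\in[s]$; $\alpha:=\{i:\lambda_i(X)>0\}$, $\beta:=\{i:\lambda_i(X)=0=\lambda_i(S)\}$, $\gamma:=\{i:\lambda_i(S)<0\}$ (so $\alpha_p=\beta\cup\gamma_2\cup\cdots\cup\gamma_s$); $\alpha^*,\beta^*,\gamma^*$ are these sets for $(X^*,S^* )$. For a matrix $M$, $M_{J_1J_2}$ is the submatrix with row indices $J_1$ and column indices $J_2$, and $M_J$ is the submatrix of the columns indexed by $J$. *)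

(* Defs.v *)
From HB Require Import structures.
From mathcomp Require Import all_boot all_order all_algebra.
From mathcomp Require Import sesquilinear.
From mathcomp Require Import all_classical all_reals all_analysis.

Set Implicit Arguments.
Unset Strict Implicit.
Unset Printing Implicit Defensive.

Import Order.TTheory GRing.Theory Num.Theory.
Import numFieldNormedType.Exports.

Local Open Scope classical_set_scope.
Local Open Scope ring_scope.

(* Finite-dimensional real Euclidean spaces: the norm (hence the topology) is
   the one induced by the inner product. *)
HB.mixin Record NormedModule_isEuclidean (R : realType) X
    of NormedModule R X & Vector R X := {
  inner : {dot X for idfun} ;
  inner_norm : forall x : X, inner x x = `|x| ^+ 2 }.

#[short(type="euclideanType")]
HB.structure Definition Euclidean (R : realType) :=
  { X of NormedModule R X & Vector R X & NormedModule_isEuclidean R X }.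

Arguments inner {R X} : rename.

Section SymmetricMatrices.
Context {R : realType}.

(* Trace inner product and Frobenius norm; on column vectors these are the
   standard inner product and the Euclidean norm.  The norm `|_| that the
   library puts on matrices is the max norm, with the same topology. *)
Definition mxdot m n (U V : 'M[R]_(m, n)) : R := \tr (U^T *m V).
Definition mxnorm m n (U : 'M[R]_(m, n)) : R := Num.sqrt (mxdot U U).

Definition symm n : set 'M[R]_n := [set M | M \is symmetricmx].

Definition psd n : set 'M[R]_n :=
  [set M | symm M /\ forall u : 'cV[R]_n, 0 <= mxdot u (M *m u)].

Definition orthogonalmx n : set 'M[R]_n := [set P | P^T *m P = 1%:M].

(* The eigenvalues of a symmetric matrix, with multiplicity and in
   nonincreasing order; this row vector exists and is unique when X is
   symmetric. *)
Definition eigvals n (X : 'M[R]_n) : 'rV[R]_n :=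
  xget 0 [set l : 'rV[R]_n | (forall i j : 'I_n, (i <= j)%N -> l 0 j <= l 0 i) /\
                  char_poly X = \prod_(i < n) ('X - (l 0 i)%:P)].

Definition orthodiag n (X : 'M[R]_n) : set 'M[R]_n :=
  [set P | orthogonalmx P /\ X = P *m diag_mx (eigvals X) *m P^T].

Definition alphaset n (X : 'M[R]_n) : {set 'I_n} :=
  [set i | 0 < eigvals X 0 i]%SET.
Definition betaset n (X S : 'M[R]_n) : {set 'I_n} :=
  [set i | (eigvals X 0 i == 0) && (eigvals S 0 i == 0)]%SET.
Definition gammaset n (S : 'M[R]_n) : {set 'I_n} :=
  [set i | eigvals S 0 i < 0]%SET.

(* The index sets alpha_1, ..., alpha_(p-1) (the classes of the distinct
   positive eigenvalues of X), beta, and gamma_2, ..., gamma_s (the classes of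
   the distinct negative eigenvalues of S). *)
Definition eigblocks n (X S : 'M[R]_n) : {set {set 'I_n}} :=
  preim_partition (eigvals X 0) (alphaset X)
  :|: [set betaset X S]%SET
  :|: preim_partition (eigvals S 0) (gammaset S).

Definition subblock n (I J : {set 'I_n}) (M : 'M[R]_n) : 'M[R]_(#|I|, #|J|) :=
  mxsub (fun i : 'I_#|I| => enum_val i) (fun j : 'I_#|J| => enum_val j) M.

Definition subcols n (J : {set 'I_n}) (M : 'M[R]_n) : 'M[R]_(n, #|J|) :=
  colsub (fun j : 'I_#|J| => enum_val j) M.

(* Q is block diagonal with respect to the family Js of disjoint index sets,
   and its diagonal blocks are orthogonal.  Since eigvals is sorted, the
   members of eigblocks X S are consecutive intervals of indices, so
   blkdiag_ortho (eigblocks X S) Q says that Q = BlkDiag(Q_1, ..., Q_p) with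
   Q_p = BlkDiag(Q_p^1, ..., Q_p^s) and orthogonal blocks of the right sizes. *)
Definition blkdiag_ortho n (Js : {set {set 'I_n}}) (Q : 'M[R]_n) : Prop :=
  (forall i j, ~ (exists2 J, J \in Js & (i \in J) && (j \in J)) -> Q i j = 0) /\
  (forall J, J \in Js -> orthogonalmx (subblock J J Q)).

End SymmetricMatrices.

Section ConvexCones.
Context {R : realType}.

Definition normal_cone (E : zmodType) (ip : E -> E -> R) (D : set E) (x : E) :
    set E :=
  [set v | forall x', D x' -> ip v (x' - x) <= 0].

Definition tangent_cone (E : normedModType R) (D : set E) (x : E) : set E :=
  closure [set d | exists t y, [/\ 0 <= t, D y & d = t *: (y - x)]].

Definition Sp (E : lmodType R) (K : set E) : set E :=
  [set d | exists t u v, [/\ 0 <= t, K u, K v & d = t *: (u - v)]].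

(* The normal cone is taken in the space of symmetric matrices. *)
Definition normal_psd n (X : 'M[R]_n) : set 'M[R]_n :=
  @symm R n `&` normal_cone (@mxdot R n n) (@psd R n) X.

(* The set of positive semidefinite matrices is closed, so it makes no
   difference that this closure is taken among all matrices. *)
Definition tangent_psd n (X : 'M[R]_n) : set 'M[R]_n :=
  tangent_cone (@psd R n) X.

End ConvexCones.

Section VariationalAnalysis.
Context {R : realType}.
Local Open Scope ereal_scope.

Definition pair_norm (E F : Type) (nE : E -> R) (nF : F -> R) (p : E * F) : R :=
  Num.sqrt (nE p.1 ^+ 2 + nF p.2 ^+ 2).

(* The distance to the empty set is +oo. *)
Definition dist (E : zmodType) (nE : E -> R) (z : E) (D : set E) : \bar R :=
  ereal_inf [set (nE (z - u)%R)%:E | u in D].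

(* Metric regularity of a multifunction F with values in the normed space
   whose underlying set is Z and whose norm is nE. *)
Definition metrically_regular (X : normedModType R) (E : zmodType)
    (Z : set E) (nE : E -> R) (F : X -> set E) (x : X) (z : E) : Prop :=
  F x z /\
  exists delta kappa : R, [/\ (0 < delta)%R, (0 < kappa)%R &
    forall x' z', Z z' ->
      closed_ball_ (pair_norm Num.norm nE) (x, z) delta (x', z') ->
      dist Num.norm x' [set u | F u z'] <= kappa%:E * dist nE z' (F x')].

Definition proper_fun (X : Type) (f : X -> \bar R) : Prop :=
  (forall x, f x != -oo) /\ exists x, f x < +oo.

Definition indicator (X : Type) (D : set X) (x : X) : \bar R :=
  if x \in D then 0 else +oo.

Definition argmin (X : Type) (D : set X) (f : X -> \bar R) : set X :=
  [set x | D x /\ forall x', D x' -> f x <= f x'].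

Context {X : euclideanType R}.

Definition tilt_stable (f : X -> \bar R) (xbar : X) : Prop :=
  f xbar < +oo /\
  exists2 delta : R, (0 < delta)%R &
    let M v := argmin (closed_ball_ Num.norm xbar delta)
                 (fun x => f x - f xbar - (inner v (x - xbar)%R)%:E) in
    M 0%R = [set xbar] /\
    exists2 V, nbhs (0%R : X) V &
      exists2 s : X -> X, forall v, V v -> M v = [set s v]
                        & [lipschitz s v | v in V].

End VariationalAnalysis.

Section Euclidean.
Context {R : realType} {X : euclideanType R}.

(* The Riesz representative of a linear form. *)
Definition riesz (l : X -> R) : X := xget 0 [set u | forall h, inner u h = l h].

Definition grad (f : X -> R) (x : X) : X := riesz ('d (f : X -> R^o) x).

(* The Hessian of f at x, as a linear operator on X. *)
Definition hess (f : X -> R) (x : X) : X -> X := 'd (grad f) x.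

Definition twice_cont_diff_on (O : set X) (f : X -> R) : Prop :=
  forall x, O x ->
    [/\ differentiable (f : X -> R^o) x, differentiable (grad f) x &
        forall w, {for x, continuous (fun y => hess f y w)}].

Definition adj p q (L : X -> 'M[R]_(p, q)) (Y : 'M[R]_(p, q)) : X :=
  riesz (fun x => mxdot Y (L x)).

End Euclidean.

Section ProblemP.
Context {R : realType} {X : euclideanType R} {m n : nat}.
Variables (A : X -> 'cV[R]_m) (b : 'cV[R]_m).
Variables (B : X -> 'M[R]_n) (B0 : 'M[R]_n).

Definition gmap (x : X) : 'M[R]_n := B x - B0.

Definition feasible : set X := A @^-1` [set b] `&` gmap @^-1` @psd R n.

Definition local_optimal (phi : X -> \bar R) (x : X) : Prop :=
  feasible x /\ \forall x' \near x, feasible x' -> (phi x <= phi x')%E.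

(* The multifunction z |-> (A z - b, g(z)) - {0} x S^n_+. *)
Definition Gmap (z : X) : set ('cV[R]_m * 'M[R]_n) :=
  [set (A z - b, gmap z - V) | V in @psd R n].

(* The metric regularity of Gmap, its values being taken in the Euclidean space
   of pairs of a vector and a symmetric matrix. *)
Definition Gmap_metrically_regular (x : X) : Prop :=
  metrically_regular [set p : 'cV[R]_m * 'M[R]_n | symm p.2]
    (pair_norm (@mxnorm R m 1) (@mxnorm R n n)) Gmap x (0, 0).

Definition multipliers (x v : X) : set ('cV[R]_m * 'M[R]_n) :=
  [set p | [/\ normal_cone inner feasible x v, normal_psd (gmap x) p.2 &
               adj A p.1 + adj B p.2 = v]].

(* The sets called \widehat\Upsilon and \widehat\Upsilon^*, for X = Xs and
   S = Ss. *)
Definition Upsilon (Xs Ss : 'M[R]_n) : set X :=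
  let alpha := alphaset Xs in
  let beta := betaset Xs Ss in
  let gamma := gammaset Ss in
  [set w | exists (bm bp b0 gt : {set 'I_n}) (P Q : 'M[R]_n),
    let W := (P *m Q)^T *m B w *m (P *m Q) in
    [/\ gamma \subset gt,
        (orthodiag Xs `&` orthodiag Ss) P,
        blkdiag_ortho (eigblocks Xs Ss) Q &
        (orthodiag Xs `&` orthodiag Ss) (P *m Q)] /\
    [/\ beta = bm :|: bp :|: b0 :|: (gt :\: gamma),
        psd (subblock b0 b0 W),
        subblock (b0 :|: bm :|: gt) (bm :|: gt) W = 0 &
        subblock (alpha :|: bp) gt W = 0]].

Definition Upsilon_star (Xs Ss : 'M[R]_n) : set X :=
  let alpha := alphaset Xs in
  let beta := betaset Xs Ss in
  let gamma := gammaset Ss in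
  [set w | exists2 P, (orthodiag Xs `&` orthodiag Ss) P &
    (row_mx (row_mx (subcols alpha P) (subcols beta P)) (subcols gamma P))^T
      *m B w *m subcols gamma P = 0].

End ProblemP.

(* Main.v *)
Require Import Defs.
From HB Require Import structures.
From mathcomp Require Import all_boot all_order all_algebra.
From mathcomp Require Import sesquilinear.
From mathcomp Require Import all_classical all_reals all_analysis.
From mathcomp Require Import ring lra.

Set Implicit Arguments.
Unset Strict Implicit.
Unset Printing Implicit Defensive.

Import Order.TTheory GRing.Theory Num.Theory.
Import numFieldNormedType.Exports.

Local Open Scope classical_set_scope.
Local Open Scope ring_scope.

(** Both index-set descriptions in the conclusion collapse to one linear
condition.  The multiplier [Ss] is negative semidefinite and [Xs *m Ss = 0],
and a direction w belongs to either of the two sets exactly when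
[B w *m Ss = 0] ([UpsilonP], [Upsilon_starP]): each set of block conditions
makes the gamma columns of [P^T *m B w *m P] vanish, and conversely one may
take beta_+ to be all of beta.  The equivalence is thus an equality of sets,
and what has to be excluded is a nonzero w with [hess w = 0], [A w = 0] and
[B w *m Ss = 0].

Metric regularity forces a normal [S] with [adj A y + adj B S = 0] to vanish,
which turns condition (B) into condition (A) ([regular_nondegenerate]).  Dually,
(A) says that the compression of [B d] to the kernel of [Xs] can be prescribed
freely with d in the kernel of [A] ([nondegenerate_onto]).

Tilt stability enters through a Lipschitz estimate for pairs (x, v) such that
[v - grad phi x] is normal to the feasible set at x up to an error k^2
([tilt_stable_approx_stationary]).  The solution map sol of the tilted problems
is monotone and Lipschitz, so [v + rho (sol v - sol 0)] can be solved for v up to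
any precision ([monotone_lipschitz_approx_onto]).  Solving it for the right-hand
side [v + rho (x - xs)], with rho larger than the Lipschitz constant of the
gradient, produces a point of the graph of sol within O(k) of (x, v).  Hence
[ |x1 - x2| <= C (|v1 - v2| + k) ] for two such pairs.

A flat direction w contradicts this estimate.  Choose d in the kernel of [A] such
that [B d], compressed to the kernel of [Xs], is the projector onto the beta
space, and a second-order correction e.  After scaling w, both
[xs + s d + s^2 e] and the same point moved by [s w] are feasible for small s
([curve_psd]).  Rotating [Ss] by an angle of order s gives one multiplier that
is complementary to both points up to [eta s^2], with eta as small as desired
([curve_complementarity]), so that k may be a small multiple of s.  The two points share this multiplier, so the
corresponding tilts v1 and v2 differ only by a difference of gradients, which
is o(s) because the Hessian vanishes on w; but the points differ by s |w|. *)

(** * Euclidean spaces *)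

(** Common source of every Cauchy-Schwarz type inequality below: apply it to
t |-> q(u + t v) for a form q that is nonnegative. *)
Lemma quadratic_ge0_discr (R : realFieldType) (a b c : R) :
  0 <= c -> (forall t, 0 <= a + 2 * t * b + t ^+ 2 * c) -> b ^+ 2 <= a * c.
Proof.
move=> c0 H; have [c1|c1] := eqVneq c 0.
  have [->|b1] := eqVneq b 0; first by rewrite c1 expr0n mulr0.
  (* With c = 0 the polynomial is affine; this t gives it the value - 1. *)
  have := H (- (a + 1) / (2 * b)); rewrite c1 mulr0 addr0.
  have -> : 2 * (- (a + 1) / (2 * b)) * b = - (a + 1) by field.
  lra.
have cp : 0 < c by rewrite lt_neqAle eq_sym c1.
have := H (- b / c).
have -> : a + 2 * (- b / c) * b + (- b / c) ^+ 2 * c = (a * c - b ^+ 2) / c by field.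
by rewrite pmulr_lge0 ?invr_gt0 // subr_ge0.
Qed.

Section Inner.
Context {R : realType} {X : euclideanType R}.
Implicit Types x y z u v : X.

Lemma innerDl x y z : inner (x + y) z = inner x z + inner y z.
Proof. exact: linearDl. Qed.
Lemma innerDr x y z : inner z (x + y) = inner z x + inner z y.
Proof. exact: linearDr. Qed.
Lemma innerNl x z : inner (- x) z = - inner x z.
Proof. exact: linearNl. Qed.
Lemma innerNr x z : inner z (- x) = - inner z x.
Proof. exact: linearNr. Qed.
Lemma innerZl a x z : inner (a *: x) z = a * inner x z.
Proof. exact: linearZl_LR. Qed.
Lemma innerZr a x z : inner z (a *: x) = a * inner z x.
Proof. exact: linearZr_LR. Qed.
Lemma inner0l z : inner (0 : X) z = 0.
Proof. exact: linear0l. Qed.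
Lemma inner0r z : inner z (0 : X) = 0.
Proof. exact: linear0r. Qed.
Lemma innerBl x y z : inner (x - y) z = inner x z - inner y z.
Proof. by rewrite innerDl innerNl. Qed.
Lemma innerBr x y z : inner z (x - y) = inner z x - inner z y.
Proof. by rewrite innerDr innerNr. Qed.
Lemma inner_suml I (r : seq I) (F : I -> X) z :
  inner (\sum_(i <- r) F i) z = \sum_(i <- r) inner (F i) z.
Proof. by elim/big_rec2: _ => [|i ? ? _ <-]; rewrite ?inner0l ?innerDl. Qed.
Lemma inner_sumr I (r : seq I) (F : I -> X) z :
  inner z (\sum_(i <- r) F i) = \sum_(i <- r) inner z (F i).
Proof. by elim/big_rec2: _ => [|i ? ? _ <-]; rewrite ?inner0r ?innerDr. Qed.
Lemma innerC x y : inner x y = inner y x.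
Proof. by rewrite hermC /= expr0 mul1r. Qed.

Definition innerE := (innerDl, innerDr, innerNl, innerNr, innerZl, innerZr).

Lemma inner_ge0 x : 0 <= inner x x.
Proof. by rewrite inner_norm sqr_ge0. Qed.

Lemma cauchy_schwarz x y : `|inner x y| <= `|x| * `|y|.
Proof.
rewrite -(@ler_pXn2r _ 2) ?nnegrE ?mulr_ge0 // real_normK ?num_real //.
rewrite exprMn -!inner_norm; apply: quadratic_ge0_discr => [|t].
  exact: inner_ge0.
have := inner_ge0 (x + t *: y); rewrite !innerE (innerC y x) => H.
by apply: le_trans H _; rewrite le_eqVlt; apply/orP; left; apply/eqP; ring.
Qed.

Lemma inner_le x y : inner x y <= `|x| * `|y|.
Proof. exact: le_trans (ler_norm _) (cauchy_schwarz _ _). Qed.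

Lemma inner_eq0 x : (forall y, inner x y = 0) -> x = 0.
Proof.
by move=> /(_ x); rewrite inner_norm => /eqP; rewrite sqrf_eq0 normr_eq0 => /eqP.
Qed.

Lemma inner_inj x y : (forall z, inner x z = inner y z) -> x = y.
Proof.
move=> H; apply/eqP; rewrite -subr_eq0; apply/eqP/inner_eq0 => z.
by rewrite innerBl H subrr.
Qed.

End Inner.

Section OrthonormalBasis.
Context {R : realType} {X : euclideanType R}.
Local Notation N := (\dim {: X}).

Let orthonormal_upto k (e : nat -> X) :=
  forall i j, (i < k)%N -> (j < k)%N -> inner (e i) (e j) = (i == j)%:R.

(** Gram-Schmidt: while k is below the dimension some vector lies outside the
span of the first k, and its component orthogonal to them is normalized. *)
Lemma orthonormal_family k : (k <= N)%N -> exists e : nat -> X, orthonormal_upto k e.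
Proof.
elim: k => [_|k IH kN]; first by exists (fun=> 0).
have [e eo] := IH (ltnW kN).
pose s := mkseq e k.
have : ~~ ({: X} <= span s)%VS.
  apply/negP => /dimvS H; have := leq_trans H (dim_span s).
  by rewrite size_mkseq leqNgt kN.
case/subvPn => x _ xs.
pose y := x - \sum_(i < k) inner (e i) x *: e i.
have y0 : y != 0.
  apply: contra xs; rewrite subr_eq0 => /eqP ->.
  apply: memv_suml => i _; apply: memvZ; apply: memv_span.
  by apply/mapP; exists (i : nat) => //; rewrite mem_iota add0n ltn_ord.
have ye j : (j < k)%N -> inner (e j) y = 0.
  move=> jk; rewrite innerBr inner_sumr (bigD1 (Ordinal jk)) //= innerZr eo // eqxx mulr1.
  rewrite big1 ?addr0 ?subrr // => i ij; rewrite innerZr eo //.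
  by move: ij; rewrite -(inj_eq val_inj) /= eq_sym => /negbTE ->; rewrite mulr0.
exists (fun j => if j == k then `|y|^-1 *: y else e j) => i j.
have ny : `|y| != 0 by rewrite normr_eq0.
rewrite !ltnS => ik jk; have [ei|ik'] := eqVneq i k; have [ej|jk'] := eqVneq j k.
- by rewrite ei ej eqxx innerZl innerZr inner_norm expr2 mulKf // mulVf.
- rewrite ei eq_sym (negbTE jk') innerZl innerC ye ?mulr0 //.
  by rewrite ltn_neqAle jk' jk.
- rewrite ej (negbTE ik') innerZr ye ?mulr0 //.
  by rewrite ltn_neqAle ik' ik.
- by apply: eo; rewrite ltn_neqAle ?ik' ?jk'.
Qed.

Lemma orthonormal_basis : exists e : 'I_N -> X,
  (forall i j, inner (e i) (e j) = (i == j)%:R) /\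
  forall x, x = \sum_i inner (e i) x *: e i.
Proof.
have [e eo] := orthonormal_family (leqnn N).
pose t : N.-tuple X := [tuple e i | i < N].
have tE (i : 'I_N) : t`_i = e i by rewrite -tnth_nth tnth_mktuple.
have ft : free t.
  apply/freeP => c c0 i; have /(congr1 (inner (e i))) := c0.
  rewrite inner_sumr inner0r (bigD1 i) //= innerZr tE eo // eqxx mulr1.
  rewrite big1 ?addr0 // => j ji; rewrite innerZr tE eo //.
  by move: ji; rewrite -(inj_eq val_inj) /= eq_sym => /negbTE ->; rewrite mulr0.
have st : (span t = fullv)%VS.
  by apply/eqP; rewrite eqEdim subvf /= (eqP ft) size_tuple.
exists (fun i => e i); split=> [i j|x]; first by rewrite eo.
have xt : x \in span t by rewrite st memvf.
have xE := coord_span xt.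
rewrite {1}xE; apply: eq_bigr => i _; rewrite tE; congr (_ *: _).
rewrite {2}xE inner_sumr (bigD1 i) //= innerZr tE eo // eqxx mulr1.
rewrite big1 ?addr0 // => j ji; rewrite innerZr tE eo //.
by move: ji; rewrite -(inj_eq val_inj) /= eq_sym => /negbTE ->; rewrite mulr0.
Qed.

(** The coordinates in an orthonormal basis are bounded by the norm, so in finite
dimension linearity suffices for boundedness. *)
Lemma linear_bounded (V : normedModType R) (f : {linear X -> V}) :
  exists2 C, 0 < C & forall x, `|f x| <= C * `|x|.
Proof.
have [e [eo ex]] := orthonormal_basis.
exists (1 + \sum_i `|f (e i)|) => [|x].
  by apply: ltr_wpDr => //; apply: sumr_ge0.
rewrite {1}(ex x) linear_sum mulrDl mul1r; apply: ler_wpDl => //.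
apply: le_trans (ler_norm_sum _ _ _) _; rewrite mulr_suml; apply: ler_sum => i _.
rewrite linearZ normrZ mulrC ler_wpM2l //.
apply: le_trans (cauchy_schwarz _ _) _.
by rewrite -(@ler_pXn2r _ 2) ?nnegrE ?mulr_ge0 // exprMn -inner_norm eo eqxx mul1r.
Qed.

(** The Riesz vector of l is the sum of the l (e i) *: e i over an orthonormal
basis, which shows that the choice made by [riesz] is effective. *)
Lemma rieszE (l : X -> R) : linear_for *%R l -> forall h, inner (riesz l) h = l h.
Proof.
move=> ll; have [e [eo ex]] := orthonormal_basis.
have lD x y : l (x + y) = l x + l y by have := ll 1 x y; rewrite scale1r mul1r.
have l0 : l 0 = 0 by apply: (addrI (l 0)); rewrite -lD !addr0.
have lZ a x : l (a *: x) = a * l x by have := ll a x 0; rewrite addr0 l0 addr0.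
rewrite /riesz; case: xgetP => [_ -> //|/(_ (\sum_i l (e i) *: e i)) []] /= h.
rewrite inner_suml [in RHS](ex h).
have -> : l (\sum_i inner (e i) h *: e i) = \sum_i l (inner (e i) h *: e i).
  by elim/big_rec2: _ => [|i ? ? _ <-]; rewrite ?l0 ?lD.
by apply: eq_bigr => i _; rewrite innerZl lZ mulrC.
Qed.

End OrthonormalBasis.

(** * Gradient and Hessian near the reference point *)

Section Calculus.
Context {R : realType} {X : euclideanType R}.
Implicit Types (f : X -> R) (x y u w : X).

Lemma gradE f x h : inner (grad f x) h = 'd (f : X -> R^o) x h.
Proof. by apply: rieszE => a u v; rewrite linearP. Qed.

Lemma hessZ f x (a : R) w : hess f x (a *: w) = a *: hess f x w.
Proof. exact: linearZ. Qed.

Lemma ball_convex (x0 : X) (r : R) x y (c : R) : 0 <= c <= 1 ->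
  `|x - x0| < r -> `|y - x0| < r -> `|x + c *: (y - x) - x0| < r.
Proof.
move=> /andP[c0 c1] xr yr.
have -> : x + c *: (y - x) - x0 = (1 - c) *: (x - x0) + c *: (y - x0).
  rewrite scalerBl scale1r -[RHS]addrA [- _ + _]addrC -scalerBr opprB addrA subrK.
  by rewrite addrAC.
apply: le_lt_trans (ler_normD _ _) _; rewrite !normrZ.
rewrite ger0_norm ?subr_ge0 // (ger0_norm c0).
have [->|c2] := eqVneq c 0; first by rewrite subr0 mul0r mul1r addr0.
have cp : 0 < c by rewrite lt_neqAle eq_sym c2.
have : (1 - c) * `|x - x0| <= (1 - c) * r by rewrite ler_wpM2l ?subr_ge0 // ltW.
have : c * `|y - x0| < c * r by rewrite ltr_pM2l.
lra.
Qed.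

(** Restriction to a line, which brings the one-variable mean value theorem
within reach. *)
Lemma is_derive_line (g : X -> R^o) x d (t : R) : differentiable g (x + t *: d) ->
  is_derive t 1 (fun s : R => g (x + s *: d) : R^o) ('d g (x + t *: d) d).
Proof.
move=> dg; have dp : is_diff t (fun s : R^o => x + s *: d) (fun s : R^o => s *: d).
  have h1 : is_diff (t : R^o) (cst x : R^o -> X) 0 by exact: is_diff_cst.
  have h2 : is_diff (t : R^o) ( *:%R^~ d : R^o -> X) ( *:%R^~ d) by exact: is_diff_scalel.
  apply: (is_diff_eq (is_diffD h1 h2)); apply/funext => s.
  by rewrite fctE add0r.
have dgp : differentiable (g \o (fun s : R^o => x + s *: d)) t.
  by apply: differentiable_comp => //; exact: ex_diff.
split; first exact: diff_derivable.
by rewrite deriveE // diff_comp //= diff_val scale1r.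
Qed.

Lemma differentiable_inner (G : X -> X) x u : differentiable G x ->
  differentiable ((fun z => inner (G z) u) : X -> R^o) x /\
  'd ((fun z => inner (G z) u) : X -> R^o) x = (fun h => inner ('d G x h) u) :> (X -> R^o).
Proof.
move=> dG.
have lin : linear (fun z : X => inner z u : R^o) by move=> a y z; rewrite !innerE.
pose Lm := GRing.isLinear.Build _ _ _ _ _ lin.
pose L : {linear X -> R^o} := HB.pack (fun z : X => inner z u : R^o) Lm.
have Lc : continuous L.
  have [C C0 HC] := linear_bounded L.
  apply/linear_bounded_continuous/bounded_funP => r.
  exists (C * r) => z zr; apply: le_trans (HC z) _.
  by rewrite ler_pM2l.
have dL : differentiable L (G x) by exact: linear_differentiable.
split; first exact: (differentiable_comp dG dL).
by rewrite (diff_comp dG dL) diff_lin.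
Qed.

(** The mean value theorem fails for vector-valued maps; it is applied to the
scalar function obtained by pairing the gradient with a fixed u. *)
Lemma grad_mvt f x y u :
  (forall c : R, 0 <= c <= 1 -> differentiable (grad f) (x + c *: (y - x))) ->
  exists2 c : R, 0 <= c <= 1 &
    inner (grad f y - grad f x) u = inner (hess f (x + c *: (y - x)) (y - x)) u.
Proof.
move=> H; pose k (s : R) : R := inner (grad f (x + s *: (y - x))) u.
have dk (c : R) : 0 <= c <= 1 ->
    is_derive c 1 k (inner (hess f (x + c *: (y - x)) (y - x)) u).
  move=> c01; have [d1 d2] := differentiable_inner u (H c c01).
  have := is_derive_line d1; rewrite d2; exact.
have [c| |c c01] := @MVT_segment R k (fun c => inner (hess f (x + c *: (y - x)) (y - x)) u)
  0 1 ler01.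
- by rewrite in_itv /= => /andP[c0 c1]; apply: dk; rewrite !ltW.
- apply: continuous_in_subspaceT => c; rewrite inE /= in_itv /= => c01.
  apply/differentiable_continuous/derivable1_diffP.
  by case: (dk c c01).
- rewrite subr0 mulr1 /k scale1r scale0r addr0 [x + (y - x)]addrC subrK -innerBl => ->.
  by exists c => //; move: c01; rewrite in_itv.
Qed.

Lemma grad_increment f x y (K : R) : 0 <= K ->
  (forall c : R, 0 <= c <= 1 -> differentiable (grad f) (x + c *: (y - x))) ->
  (forall c : R, 0 <= c <= 1 -> `|hess f (x + c *: (y - x)) (y - x)| <= K) ->
  `|grad f y - grad f x| <= K.
Proof.
move=> K0 dG HK; have [c c01 E] := grad_mvt (grad f y - grad f x) dG.
have [-> |g0] := eqVneq (grad f y - grad f x) 0; first by rewrite normr0.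
have gp : 0 < `|grad f y - grad f x| by rewrite normr_gt0.
rewrite -(ler_pM2r gp) -expr2 -inner_norm E.
by apply: le_trans (inner_le _ _) _; rewrite ler_pM2r // HK.
Qed.

Section C2.
Variables (O : set X) (f : X -> R) (xs : X).
Hypotheses (Oopen : open O) (fC2 : twice_cont_diff_on O f) (Oxs : O xs).

Lemma C2_ball : exists2 r : R, 0 < r & forall x, `|x - xs| < r -> O x.
Proof.
have /nbhs_ballP [r r0 H] : nbhs xs O by exact: open_nbhs_nbhs.
exists r => // x xr; apply: H; rewrite -ball_normE /= distrC //.
Qed.

(** Continuity of the Hessian is only pointwise in the direction w, hence the
radius depends on w. *)
Lemma hess_near w (e : R) : 0 < e -> exists2 r : R, 0 < r &
  forall x, `|x - xs| < r -> O x /\ `|hess f x w| < `|hess f xs w| + e.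
Proof.
move=> e0; have [r r0 Hr] := C2_ball.
have [_ _ /(_ w)] := fC2 Oxs.
move=> /cvgrPdist_lt /(_ e e0) /nbhs_ballP [r' r'0 H].
exists (Num.min r r') => [|x]; first by rewrite lt_min r0.
rewrite lt_min => /andP[xr xr']; split; first exact: Hr.
have := H x; rewrite -ball_normE /= distrC => /(_ xr') Hx.
have -> : hess f x w = hess f xs w - (hess f xs w - hess f x w) by rewrite opprB addrC subrK.
by apply: le_lt_trans (ler_normB _ _) _; rewrite ltrD2l.
Qed.

(** Pointwise continuity of the Hessian bounds it on each vector of an
orthonormal basis near xs, hence uniformly as an operator. *)
Lemma grad_lipschitz : exists K r : R, [/\ 0 < K, 0 < r &
  forall x y, `|x - xs| < r -> `|y - xs| < r ->
    `|grad f y - grad f x| <= K * `|y - x|].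
Proof.
have [e [eo ex]] := @orthonormal_basis R X.
have Hx i : exists r : R, 0 < r /\ forall x, `|x - xs| < r ->
    O x /\ `|hess f x (e i)| < `|hess f xs (e i)| + 1.
  by have [r r0 H] := hess_near (e i) ltr01; exists r.
have [rr Hrr] := boolp.choice Hx.
have [r0 r00 Hr0] := C2_ball.
pose r := \big[Num.min/r0]_i rr i.
have rp : 0 < r by apply: lt_bigmin => // i _; case: (Hrr i).
pose K := 1 + \sum_i (`|hess f xs (e i)| + 1).
have Kp : 0 < K by apply: ltr_wpDr => //; apply: sumr_ge0 => i _; apply: addr_ge0.
have HK x w : `|x - xs| < r -> `|hess f x w| <= K * `|w|.
  move=> xr; rewrite /hess {1}(ex w) linear_sum mulrDl mul1r; apply: ler_wpDl => //.
  apply: le_trans (ler_norm_sum _ _ _) _; rewrite mulr_suml; apply: ler_sum => i _.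
  rewrite linearZ normrZ mulrC; apply: ler_pM => //; rewrite -?/(hess f x _).
    apply/ltW; apply: (proj2 (Hrr i) x _).2; apply: lt_le_trans xr _.
    exact: bigmin_le_cond.
  apply: le_trans (cauchy_schwarz _ _) _.
  by rewrite -(@ler_pXn2r _ 2) ?nnegrE ?mulr_ge0 // exprMn -inner_norm eo eqxx mul1r.
exists K, r; split=> // x y xr yr; apply: grad_increment => [|c c01|c c01].
- by rewrite mulr_ge0 // ltW.
- have /Hr0 /fC2 [] // : `|x + c *: (y - x) - xs| < r0.
  by apply: lt_le_trans (ball_convex c01 xr yr) _; exact: bigmin_le_id.
- by apply: HK; exact: ball_convex.
Qed.

(** Where the Hessian vanishes on w at xs, moving along w changes the gradient
by o(t), uniformly in the starting point near xs. *)
Lemma grad_flat w (e : R) : 0 < e -> hess f xs w = 0 -> exists2 r : R, 0 < r &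
  forall x (t : R), 0 <= t -> `|x - xs| < r -> `|x + t *: w - xs| < r ->
    `|grad f (x + t *: w) - grad f x| <= t * e.
Proof.
move=> e0 Hw; have [r r0 H] := hess_near w e0.
exists r => // x t t0 xr yr.
have seg c : 0 <= c <= 1 -> `|x + c *: (x + t *: w - x) - xs| < r.
  by move=> c01; apply: ball_convex.
apply: grad_increment => [|c c01|c c01]; first by rewrite mulr_ge0 // ltW.
- by have [/fC2 [] //] := H _ (seg c c01).
- have E : x + t *: w - x = t *: w by rewrite addrAC subrr add0r.
  have [_] := H _ (seg c c01); rewrite Hw normr0 add0r E => /ltW Hle.
  by rewrite hessZ normrZ ger0_norm // ler_wpM2l.
Qed.

End C2.
End Calculus.

(** * Monotone Lipschitz perturbations of the identity *)

Section Minty.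
Context {R : realType} {X : euclideanType R}.

Lemma normD_sqr (x y : X) : `|x + y| ^+ 2 = `|x| ^+ 2 + 2 * inner x y + `|y| ^+ 2.
Proof. by rewrite -!inner_norm !innerE (innerC y x); ring. Qed.

Lemma geometric_small (q c e : R) : 0 <= q < 1 -> 0 < e -> exists k, q ^+ k * c <= e.
Proof.
move=> /andP[q0 q1] e0.
have : (fun k => q ^+ k * c) @ \oo --> 0 * c.
  by apply: cvgM; [apply: cvg_expr; rewrite ger0_norm|exact: cvg_cst].
rewrite mul0r => /cvgrPdist_le /(_ e e0) [k _ /(_ k (leqnn k))] /=.
by rewrite sub0r normrN => H; exists k; apply: le_trans H; exact: ler_norm.
Qed.

(** For F v = v + rho (s v - s 0), the step u = - t (F v - z) multiplies the
residual F v - z by a factor below 1 when t is small, because F is strongly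
monotone and Lipschitz.  The steps sum to at most 2 |z|, so the iteration
remains in the ball where s is controlled. *)
Lemma monotone_lipschitz_approx_onto (s : X -> X) (r L rho : R) :
  0 < r -> 0 < L -> 0 < rho ->
  (forall v v' : X, `|v| < r -> `|v'| < r -> 0 <= inner (v - v') (s v - s v')) ->
  (forall v v', `|v| < r -> `|v'| < r -> `|s v - s v'| <= L * `|v - v'|) ->
  forall z, 2 * `|z| < r -> forall e, 0 < e ->
    exists2 v, `|v| < r & `|v + rho *: (s v - s 0) - z| <= e.
Proof.
move=> r0 L0 rho0 smono slip z zr e e0.
pose F v := v + rho *: (s v - s 0).
pose K := 1 + rho * L; have K1 : 1 <= K by rewrite lerDl mulr_ge0 // ltW.
have K0 : 0 < K by apply: lt_le_trans K1.
(* At this t the squared contraction factor 1 - 2 t + K^2 t^2 is least and equals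
   1 - t; its square root is at most q. *)
pose t := (K ^+ 2)^-1; have t0 : 0 < t by rewrite invr_gt0 exprn_gt0.
have t1 : t <= 1 by rewrite invf_le1 ?exprn_gt0 // exprn_ege1.
have tK : K ^+ 2 * t = 1 by rewrite mulfV // gt_eqF // exprn_gt0.
pose q := 1 - t / 2.
have q0 : 0 <= q by rewrite /q; lra.
have q1 : q < 1 by rewrite /q; lra.
have step k : exists2 v, `|v| <= 2 * `|z| * (1 - q ^+ k) & `|F v - z| <= q ^+ k * `|z|.
  elim: k => [|k [v vk Fk]].
    exists 0; first by rewrite normr0 expr0 subrr mulr0.
    by rewrite /F subrr scaler0 addr0 add0r normrN expr0 mul1r.
  have qk0 : 0 <= q ^+ k by rewrite exprn_ge0.
  have qk1 : q ^+ k <= 1 by rewrite exprn_ile1 // ltW.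
  have bound k' (w : X) : 0 <= q ^+ k' -> `|w| <= 2 * `|z| * (1 - q ^+ k') -> `|w| < r.
    move=> Q H; apply: le_lt_trans H (le_lt_trans _ zr).
    by rewrite ler_piMr ?mulr_ge0 // gerBl.
  set E := F v - z in Fk; pose u := - t *: E.
  have nu : `|u| = t * `|E| by rewrite normrZ normrN gtr0_norm.
  have vu : `|v + u| <= 2 * `|z| * (1 - q ^+ k.+1).
    apply: le_trans (ler_normD _ _) _; rewrite nu.
    have : t * `|E| <= t * (q ^+ k * `|z|) by rewrite ler_pM2l.
    have -> : 2 * `|z| * (1 - q ^+ k.+1) = 2 * `|z| * (1 - q ^+ k) + t * (q ^+ k * `|z|).
      by rewrite exprS /q; field.
    by move=> H; apply: lerD.
  exists (v + u) => //.
  have vr := bound _ _ qk0 vk.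
  have vur : `|v + u| < r by apply: (bound k.+1) => //; rewrite exprn_ge0.
  pose G := F (v + u) - F v.
  have GE : G = u + rho *: (s (v + u) - s v).
    by rewrite /G /F opprD addrACA [v + u]addrC addrK -scalerBr opprB addrA subrK.
  have H1 : `|u| ^+ 2 <= inner u G.
    rewrite GE innerDr -(inner_norm u) lerDl [inner _ (rho *: _)]innerZr mulr_ge0 ?(ltW rho0) //.
    by have := smono _ _ vur vr; rewrite [v + u]addrC addrK.
  have H2 : `|G| <= K * `|u|.
    rewrite GE; apply: le_trans (ler_normD _ _) _.
    rewrite mulrDl mul1r lerD2l normrZ gtr0_norm // -mulrA ler_pM2l //.
    by have := slip _ _ vur vr; rewrite [v + u]addrC addrK.
  have -> : F (v + u) - z = E + G by rewrite /E /G [RHS]addrC addrA subrK.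
  rewrite exprS -mulrA; apply: (@le_trans _ _ (q * `|E|)); last by rewrite ler_wpM2l.
  rewrite -(@ler_pXn2r _ 2) ?nnegrE ?mulr_ge0 // normD_sqr.
  have H3 : `|G| ^+ 2 <= K ^+ 2 * `|u| ^+ 2.
    by rewrite -exprMn ler_pXn2r ?nnegrE ?mulr_ge0 // ltW.
  move: H1; rewrite /u innerZl -/u => H1.
  have H4 : t * inner E G <= - (t * (t * `|E| ^+ 2)).
    by move: H1; rewrite nu exprMn expr2; lra.
  have H5 : inner E G <= - (t * `|E| ^+ 2) by rewrite -(ler_pM2l t0) mulrN.
  have H6 : K ^+ 2 * `|u| ^+ 2 = t * `|E| ^+ 2.
    by rewrite nu exprMn expr2 [t ^+ 2]expr2 !mulrA -expr2 tK mul1r.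
  have H7 : q ^+ 2 * `|E| ^+ 2 = `|E| ^+ 2 - t * `|E| ^+ 2 + (t / 2) ^+ 2 * `|E| ^+ 2.
    by rewrite /q; field.
  have H8 : 0 <= (t / 2) ^+ 2 * `|E| ^+ 2 by rewrite mulr_ge0 // sqr_ge0.
  rewrite exprMn H7; lra.
have [k Hk] : exists k, q ^+ k * `|z| <= e by apply: geometric_small; rewrite ?q0.
have [v vk Fk] := step k; exists v; last exact: le_trans Fk Hk.
apply: le_lt_trans vk (le_lt_trans _ zr).
by rewrite ler_piMr ?mulr_ge0 // gerBl exprn_ge0.
Qed.

End Minty.

(** * Approximately stationary points of a tilt-stable problem *)

Section TiltStability.
Context {R : realType} {X : euclideanType R}.
Variables (phi : X -> \bar R) (O D : set X) (xs : X).
Hypotheses (phiNy : forall x, phi x != -oo%E) (Oopen : open O) (DO : D `<=` O)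
  (phi_fin : forall x, O x -> phi x \is a fin_num)
  (phi_C2 : twice_cont_diff_on O (fine \o phi)) (Dxs : D xs)
  (D_convex : forall x y (c : R), 0 <= c <= 1 -> D x -> D y -> D (x + c *: (y - x))).

Let F : X -> R := fine \o phi.
Let f x := (phi x + indicator D x)%E.

Lemma objective_fin x : D x -> f x = (F x)%:E.
Proof.
by move=> Dx; rewrite /f /indicator mem_set // adde0 /F /= fineK // phi_fin //; exact: DO.
Qed.

(** Outside D the objective is +oo, so a minimizer lies in D and the comparison
with the other points of D takes place between real numbers. *)
Lemma tilted_argminP delta v x : 0 < delta ->
  argmin (closed_ball_ Num.norm xs delta)
    (fun x => f x - f xs - (inner v (x - xs)%R)%:E)%E x ->
  [/\ D x, `|x - xs| <= delta & forall z, D z -> `|z - xs| <= delta ->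
     F x - inner v x <= F z - inner v z].
Proof.
move=> d0 [xd H].
have H0 : closed_ball_ Num.norm xs delta xs by rewrite /closed_ball_ /= subrr normr0 ltW.
have Dx : D x.
  apply: contrapT => Dx; have := H _ H0.
  rewrite (objective_fin Dxs) subrr inner0r -!EFinB !subrr /f /indicator memNset //.
  by rewrite addey // addye // addye.
split=> // [|z Dz zd]; first by rewrite distrC.
have := H z; rewrite /closed_ball_ /= distrC => /(_ zd).
by rewrite !objective_fin // -!EFinB lee_fin !innerBr; lra.
Qed.

(** First-order condition: D is convex, hence the segment from x towards z is
feasible, and for a short step it stays in the ball of the local problem. *)
Lemma argmin_stationary delta v x : D x -> `|x - xs| < delta ->
  (forall z, D z -> `|z - xs| <= delta -> F x - inner v x <= F z - inner v z) ->
  forall z, D z -> 0 <= inner (grad F x - v) (z - x).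
Proof.
move=> Dx xd H z Dz; rewrite leNgt; apply/negP => neg.
pose d := z - x; pose e := - inner (grad F x - v) d.
have e0 : 0 < e by rewrite oppr_gt0.
have [dF _ _] := phi_C2 (DO Dx).
have dFd : derivable (F : X -> R^o) x d by exact: diff_derivable.
have := dFd => /cvgrPdist_lt /(_ e e0); rewrite -/(derive _ _ _) (deriveE _ dF) -gradE.
rewrite near_withinE => /nbhs_ballP [r r0 Hr].
(* A step below r sees the difference quotient, a step below 1 stays on the
   segment, and the third bound keeps the point in the ball of radius delta. *)
pose h := Num.min (r / 2) (Num.min 1 ((delta - `|x - xs|) / (1 + `|d|))).
have d1 : 0 < 1 + `|d| by rewrite ltr_pwDl.
have h0 : 0 < h by rewrite !lt_min ltr01 divr_gt0 //= divr_gt0 // subr_gt0.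
have hr : h < r by rewrite /h gt_min; apply/orP; left; rewrite ltr_pdivrMr // ltr_pMr // ltr1n.
have h1 : h <= 1 by rewrite /h ge_min ge_min lexx orbT.
have hd : h * (1 + `|d|) <= delta - `|x - xs|.
  by rewrite -ler_pdivlMr // /h !ge_min lexx !orbT.
have := Hr h; rewrite /ball /= sub0r normrN gtr0_norm // => /(_ hr (lt0r_neq0 h0)).
have := H (x + h *: d); rewrite [h *: d + x]addrC.
have Dh : D (x + h *: d) by apply: D_convex => //; rewrite (ltW h0).
have hball : `|x + h *: d - xs| <= delta.
  rewrite addrAC; apply: le_trans (ler_normD _ _) _.
  by rewrite normrZ gtr0_norm //; move: hd; rewrite mulrDr mulr1; lra.
move=> /(_ Dh hball); rewrite [inner v (x + _)]innerDr [inner v (h *: _)]innerZr => H1.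
rewrite ltr_norml => /andP[+ _]; rewrite -/F => H2.
have H3 : inner v d <= h^-1 *: (F (x + h *: d) - F x).
  by rewrite [_ *: _]mulrC ler_pdivlMr // mulrC; move: H1; rewrite -/F /=; lra.
have eE : e = inner v d - inner (grad F x) d by rewrite /e innerBl opprB.
by move: H2 H3 => /=; rewrite eE -/F; lra.
Qed.

(** Real-valued form of tilt stability: a Lipschitz selection on a ball of tilts. *)
Lemma tilt_solution_map : tilt_stable f xs -> exists (s : X -> X) (r delta L : R),
  [/\ 0 < r, 0 < delta, 0 < L & s 0 = xs] /\
  [/\ (forall v v' : X, `|v| < r -> `|v'| < r -> `|s v - s v'| <= L * `|v - v'|),
      (forall v : X, `|v| < r -> D (s v)) &
      (forall v : X, `|v| < r -> `|s v - xs| <= delta /\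
         forall z, D z -> `|z - xs| <= delta ->
           F (s v) - inner v (s v) <= F z - inner v z)].
Proof.
case=> _ [delta d0 /= [M0 [V V0 [s Ms lips]]]].
have /nbhs_ballP [r r0 Hr] := V0.
have rV v : `|v| < r -> V v by move=> vr; apply: Hr; rewrite -ball_normE /= sub0r normrN.
case: lips => L0 [_ HL].
pose L := Num.max L0 0 + 1.
have L0' : L0 < L by rewrite /L ltr_pwDr // le_max lexx.
have Lp : 0 < L by rewrite /L ltr_wpDl // le_max lexx orbT.
have s0 : s 0 = xs.
  have : [set xs] (s 0) by rewrite -M0 Ms //; apply: rV; rewrite normr0.
  by [].
have arg (v : X) : `|v| < r -> [/\ D (s v), `|s v - xs| <= delta & forall z, D z -> `|z - xs| <= delta ->
     F (s v) - inner v (s v) <= F z - inner v z].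
  by move=> vr; apply: tilted_argminP => //; rewrite Ms //; exact: rV.
exists s, r, delta, L; split=> //; split=> [v v' vr vr'|v vr|v vr].
- by have /= := HL _ L0' (v, v') (conj (rV _ vr) (rV _ vr')).
- by have [] := arg v vr.
- by have [] := arg v vr.
Qed.

(** For each of the two pairs (x, v), let v' solve the equation
[v' + rho (sol v' - xs) = v + rho (x - xs)] up to k^2.  Then (sol v', v') is
exactly stationary, and adding the two first-order conditions gives [rho |del|^2 <= K |del|^2 + O(k^2)] for del = x - sol v', where K is the
Lipschitz constant of the gradient.  With rho = K + 1 this bounds del by 2 k. *)
Lemma tilt_stable_approx_stationary : tilt_stable f xs -> exists C r : R,
  [/\ 0 < C, 0 < r & forall (k : R) x1 x2 v1 v2, 0 < k <= 1 ->
    (forall x v, (x, v) = (x1, v1) \/ (x, v) = (x2, v2) ->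
       [/\ D x, `|x - xs| < r, `|v| < r &
           forall z, D z -> inner (v - grad F x) (z - x) <= k ^+ 2]) ->
    `|x1 - x2| <= C * (`|v1 - v2| + k)].
Proof.
move=> /tilt_solution_map [s [r0 [delta [L [[r0p d0 Lp s0] [slip sD sopt]]]]]].
have [K [rg [Kp rgp Klip]]] := grad_lipschitz Oopen phi_C2 (DO Dxs).
(* Radius 1/2 keeps the displacement del below at norm at most 1, so that the
   residual contributes k^2 |del| <= k^2. *)
pose rb := Num.min (Num.min (delta / 2) (1 / 2)) rg.
have rbp : 0 < rb by rewrite !lt_min rgp !divr_gt0.
have rbd : rb < delta by rewrite /rb !gt_min ltr_pdivrMr // ltr_pMr // ltr1n.
have rb2 : rb <= 1 / 2 by rewrite /rb !ge_min lexx orbT.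
have rbg : rb <= rg by rewrite /rb !ge_min lexx !orbT.
pose r1 := Num.min r0 (rb / L).
have r1p : 0 < r1 by rewrite lt_min r0p divr_gt0.
have r10 (v : X) : `|v| < r1 -> `|v| < r0 by rewrite lt_min => /andP[].
have near (v : X) : `|v| < r1 -> `|s v - xs| < rb.
  move=> vr; rewrite -s0; apply: le_lt_trans (slip _ _ (r10 _ vr) _) _; rewrite ?normr0 //.
  by rewrite subr0 mulrC -ltr_pdivlMr //; move: vr; rewrite lt_min => /andP[].
have smono (v v' : X) : `|v| < r1 -> `|v'| < r1 -> 0 <= inner (v - v') (s v - s v').
  move=> /r10 vr /r10 vr'; have [a1 a2] := sopt v vr; have [b1 b2] := sopt v' vr'.
  have := a2 _ (sD _ vr') b1; have := b2 _ (sD _ vr) a1; rewrite !innerE; lra.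
pose rho := K + 1; have rhop : 0 < rho by rewrite addr_gt0.
have onto := @monotone_lipschitz_approx_onto R X s r1 L rho r1p Lp rhop smono
  (fun v v' h h' => slip v v' (r10 _ h) (r10 _ h')).
pose r := Num.min rb (r1 / (2 * (1 + rho) + 1)).
have dp : 0 < 2 * (1 + rho) + 1 by lra.
have rp : 0 < r by rewrite lt_min rbp divr_gt0.
have rr1 : 2 * (1 + rho) * r < r1.
  have : r * (2 * (1 + rho) + 1) <= r1 by rewrite -ler_pdivlMr // ge_min lexx orbT.
  lra.
have rrb : r <= rb by rewrite ge_min lexx.
have key (k : R) x v : 0 < k <= 1 -> D x -> `|x - xs| < r -> `|v| < r ->
    (forall z, D z -> inner (v - grad F x) (z - x) <= k ^+ 2) ->
    exists2 v', `|v'| < r1 & `|x - s v'| <= 2 * k /\ `|v - v'| <= (2 * rho + 1) * k.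
  move=> /andP[k0 k1] Dx xr vr Hn.
  pose z := v + rho *: (x - xs).
  have zr : 2 * `|z| < r1.
    apply: le_lt_trans rr1; rewrite -mulrA ler_pM2l // mulrDl mul1r.
    apply: le_trans (ler_normD _ _) _; apply: lerD; first exact: ltW.
    by rewrite normrZ gtr0_norm // ler_pM2l // ltW.
  have [v' v'r res] := onto z zr _ (exprn_gt0 2 k0).
  exists v' => //; set y := s v' in res *.
  pose err := v' + rho *: (y - s 0) - z; rewrite -/err in res.
  pose del := x - y.
  have yb : `|y - xs| < rb by exact: near.
  have xb : `|x - xs| < rb by exact: lt_le_trans rrb.
  have Dy : D y by apply: sD; exact: r10.
  have ystat := argmin_stationary Dy (lt_trans yb rbd) (sopt _ (r10 _ v'r)).2.
  have vE : v - v' = - (rho *: del) - err.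
    have xE : x - xs = del + (y - xs) by rewrite /del addrA subrK.
    rewrite /err /z s0 xE (scalerDr rho del (y - xs)) opprB.
    move: (rho *: del) (rho *: (y - xs)) => a b'.
    by rewrite opprD addrACA addrK addrCA addNr addr0.
  have H1 := Hn y Dy; have H2 := ystat x Dx.
  have H3 : inner (grad F x - grad F y) del - inner (v - v') del <= k ^+ 2.
    have H1' : inner (grad F x - v) del <= k ^+ 2.
      by rewrite -opprB innerNl -innerNr opprB.
    have -> : inner (grad F x - grad F y) del - inner (v - v') del =
        inner (grad F x - v) del - inner (grad F y - v') del.
      rewrite -!innerBl !opprB; congr (inner _ _).
      by rewrite addrACA [RHS]addrACA [- v + _]addrC.
    by apply: le_trans H1'; rewrite gerBl.
  have H4 : - (K * `|del| ^+ 2) <= inner (grad F x - grad F y) del.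
    have : `|grad F x - grad F y| <= K * `|del| by apply: Klip; exact: lt_le_trans rbg.
    move=> H; have := cauchy_schwarz (grad F x - grad F y) del.
    rewrite ler_norml => /andP[+ _]; apply: le_trans; rewrite lerN2 expr2 mulrA.
    by rewrite ler_wpM2r.
  have H5 : - (k ^+ 2 * `|del|) <= inner err del.
    rewrite lerNl -innerNl; apply: le_trans (inner_le _ _) _.
    by rewrite normrN ler_wpM2r.
  have H6 : inner (v - v') del = - rho * `|del| ^+ 2 - inner err del.
    by rewrite vE innerBl innerNl innerZl inner_norm mulNr.
  have {}dp : 0 <= `|del| by [].
  have d1 : `|del| <= 1.
    have -> : del = (x - xs) - (y - xs) by rewrite opprB addrA subrK.
    by apply: le_trans (ler_normB _ _) _; lra.
  have H7 : `|del| ^+ 2 <= (2 * k) ^+ 2.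
    have : k ^+ 2 * `|del| <= k ^+ 2 by rewrite ler_piMr // sqr_ge0.
    have : 0 <= k ^+ 2 by rewrite sqr_ge0.
    have -> : (2 * k) ^+ 2 = 4 * k ^+ 2 by ring.
    move: H3; rewrite H6 /rho; lra.
  have H8 : `|del| <= 2 * k by move: H7; rewrite ler_pXn2r ?nnegrE // mulr_ge0 // ltW.
  split=> //; rewrite vE; apply: le_trans (ler_normB _ _) _.
  rewrite normrN normrZ gtr0_norm //.
  have : rho * `|del| <= rho * (2 * k) by rewrite ler_pM2l.
  have : k ^+ 2 <= k by rewrite expr2 ler_piMr // ltW.
  lra.
exists (4 + L + 2 * L * (2 * rho + 1)), r; split=> //.
  by rewrite !addr_gt0 // !mulr_gt0 // addr_gt0 // mulr_gt0.
move=> k x1 x2 v1 v2 k01 H.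
have [D1 X1 V1 N1] := H x1 v1 (or_introl erefl).
have [D2 X2 V2 N2] := H x2 v2 (or_intror erefl).
have [w1 w1r [xw1 vw1]] := key k x1 v1 k01 D1 X1 V1 N1.
have [w2 w2r [xw2 vw2]] := key k x2 v2 k01 D2 X2 V2 N2.
have [k0 _] := andP k01.
have -> : x1 - x2 = (x1 - s w1) + (s w1 - s w2) - (x2 - s w2).
  by rewrite opprB !subrKA.
apply: le_trans (ler_normB _ _) _.
have := ler_normD (x1 - s w1) (s w1 - s w2).
have := slip _ _ (r10 _ w1r) (r10 _ w2r).
have : L * `|w1 - w2| <= L * (`|v1 - v2| + 2 * ((2 * rho + 1) * k)).
  rewrite ler_pM2l //.
  have -> : w1 - w2 = (v1 - v2) - (v1 - w1) + (v2 - w2).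
    by rewrite opprB [v1 - v2 + _]addrC !subrKA.
  apply: le_trans (ler_normD _ _) _.
  by have := ler_normB (v1 - v2) (v1 - w1); lra.
have : 0 <= `|v1 - v2| by [].
have : 0 <= L * k by rewrite mulr_ge0 // ltW.
have : 0 <= (L * (2 * rho + 1)) * `|v1 - v2|.
  by rewrite !mulr_ge0 // ?ltW // addr_gt0 // mulr_gt0.
lra.
Qed.

End TiltStability.

(** * Trace inner product *)

Section MatrixInner.
Context {R : realType}.

Lemma symmP n (M : 'M[R]_n) : symm M <-> M^T = M.
Proof.
rewrite /symm /= is_hermitianmxE expr0 scale1r.
have -> : map_mx idfun M^T = M^T by apply/matrixP => i j; rewrite !mxE.
by split => [/eqP|->].
Qed.

Lemma mxdotE m n (U V : 'M[R]_(m, n)) : mxdot U V = \sum_i \sum_j U i j * V i j.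
Proof.
rewrite /mxdot /mxtrace exchange_big /=; apply: eq_bigr => j _; rewrite mxE.
by apply: eq_bigr => i _; rewrite mxE.
Qed.

Section Bilinear.
Context {m n : nat}.
Implicit Types (U V W : 'M[R]_(m, n)).

Lemma mxdotC U V : mxdot U V = mxdot V U.
Proof. by rewrite /mxdot -mxtrace_tr trmx_mul trmxK. Qed.
Lemma mxdotDl U V W : mxdot (U + V) W = mxdot U W + mxdot V W.
Proof. by rewrite /mxdot linearD /= mulmxDl mxtraceD. Qed.
Lemma mxdotDr U V W : mxdot W (U + V) = mxdot W U + mxdot W V.
Proof. by rewrite mxdotC mxdotDl !(mxdotC W). Qed.
Lemma mxdotZl a U W : mxdot (a *: U) W = a * mxdot U W.
Proof. by rewrite /mxdot linearZ /= -scalemxAl mxtraceZ. Qed.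
Lemma mxdotZr a U W : mxdot W (a *: U) = a * mxdot W U.
Proof. by rewrite mxdotC mxdotZl mxdotC. Qed.
Lemma mxdotNl U W : mxdot (- U) W = - mxdot U W.
Proof. by rewrite -scaleN1r mxdotZl mulN1r. Qed.
Lemma mxdotNr U W : mxdot W (- U) = - mxdot W U.
Proof. by rewrite mxdotC mxdotNl mxdotC. Qed.
Lemma mxdot0l W : mxdot 0 W = 0.
Proof. by rewrite -(scale0r W) mxdotZl mul0r. Qed.
Lemma mxdot0r W : mxdot W 0 = 0.
Proof. by rewrite mxdotC mxdot0l. Qed.
Definition mxdotBE := (mxdotDl, mxdotDr, mxdotNl, mxdotNr, mxdotZl, mxdotZr).

Lemma mxdot_ge0 U : 0 <= mxdot U U.
Proof. by rewrite mxdotE; do 2!apply: sumr_ge0 => ? _; rewrite -expr2 sqr_ge0. Qed.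
Lemma mxdot_eq0 U : mxdot U U = 0 -> U = 0.
Proof.
rewrite mxdotE => /eqP; rewrite psumr_eq0 => [|i _]; last first.
  by apply: sumr_ge0 => j _; rewrite -expr2 sqr_ge0.
move=> /allP H; apply/matrixP => i j; rewrite mxE.
have := H i (mem_index_enum _); rewrite /= psumr_eq0 => [/allP|k _]; last first.
  by rewrite -expr2 sqr_ge0.
by move=> /(_ j (mem_index_enum _)) /=; rewrite -expr2 sqrf_eq0 => /eqP.
Qed.

Lemma mxnorm_sqr U : mxnorm U ^+ 2 = mxdot U U.
Proof. by rewrite sqr_sqrtr // mxdot_ge0. Qed.
Lemma mxnorm_ge0 U : 0 <= mxnorm U.
Proof. exact: sqrtr_ge0. Qed.

Lemma mxdot_sum_l I (r : seq I) (P : pred I) (F : I -> 'M[R]_(m, n)) W :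
  mxdot (\sum_(i <- r | P i) F i) W = \sum_(i <- r | P i) mxdot (F i) W.
Proof. by elim/big_rec2: _ => [|i ? ? _ <-]; rewrite ?mxdot0l ?mxdotDl. Qed.

Lemma mxnorm_triangle U V : mxnorm (U + V) <= mxnorm U + mxnorm V.
Proof.
have UV : mxdot U V <= mxnorm U * mxnorm V.
  apply: le_trans (ler_norm _) _.
  rewrite -(@ler_pXn2r _ 2) ?nnegrE ?mulr_ge0 ?mxnorm_ge0 //.
  rewrite real_normK ?num_real // exprMn !mxnorm_sqr.
  apply: quadratic_ge0_discr (mxdot_ge0 _) _ => t.
  have := mxdot_ge0 (U + t *: V); rewrite !mxdotBE (mxdotC V U) => H.
  by apply: le_trans H _; rewrite le_eqVlt; apply/orP; left; apply/eqP; ring.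
rewrite -(@ler_pXn2r _ 2) ?nnegrE ?addr_ge0 ?mxnorm_ge0 //.
rewrite sqrrD !mxnorm_sqr !mxdotBE (mxdotC V U); lra.
Qed.

Lemma mxnormZ a U : mxnorm (a *: U) = `|a| * mxnorm U.
Proof.
by rewrite /mxnorm mxdotZl mxdotZr mulrA -expr2 sqrtrM ?sqr_ge0 // sqrtr_sqr.
Qed.

Lemma mx_coef_le_mxnorm U i j : `|U i j| <= mxnorm U.
Proof.
rewrite -(@ler_pXn2r _ 2) ?nnegrE ?mxnorm_ge0 // mxnorm_sqr mxdotE.
rewrite real_normK ?num_real // (bigD1 i) //= (bigD1 j) //= -expr2 -addrA lerDl.
apply: addr_ge0; first by apply: sumr_ge0 => ? _; rewrite -expr2 sqr_ge0.
by do 2!apply: sumr_ge0 => ? _; rewrite -expr2 sqr_ge0.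
Qed.

End Bilinear.

Lemma mxdotMl m n p (A : 'M[R]_(m, n)) (U : 'M[R]_(n, p)) (V : 'M[R]_(m, p)) :
  mxdot (A *m U) V = mxdot U (A^T *m V).
Proof. by rewrite /mxdot trmx_mul mulmxA. Qed.

Lemma mxdotMr m n p (A : 'M[R]_(m, n)) (U : 'M[R]_(n, p)) (V : 'M[R]_(m, p)) :
  mxdot V (A *m U) = mxdot (A^T *m V) U.
Proof. by rewrite mxdotC mxdotMl mxdotC. Qed.

Lemma mx_form_bound n (M : 'M[R]_n) : exists2 C, 0 < C &
  forall u v : 'cV[R]_n, `|mxdot u (M *m v)| <= C * mxnorm u * mxnorm v.
Proof.
exists (1 + \sum_i \sum_j `|M i j|) => [|u v].
  by apply: ltr_wpDr => //; do 2!apply: sumr_ge0 => ? _.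
apply: (@le_trans _ _ ((\sum_i \sum_j `|M i j|) * mxnorm u * mxnorm v)); last first.
  by rewrite !ler_wpM2r ?mxnorm_ge0 // lerDr.
rewrite mxdotE -mulrA mulr_suml; apply: le_trans (ler_norm_sum _ _ _) _.
apply: ler_sum => i _; rewrite big_ord1 mxE mulr_sumr mulr_suml.
apply: le_trans (ler_norm_sum _ _ _) _; apply: ler_sum => j _.
by rewrite !normrM mulrCA ler_wpM2l // ler_pM ?mx_coef_le_mxnorm.
Qed.

Lemma mxdot_outer n (M : 'M[R]_n) (u v : 'cV[R]_n) : mxdot M (u *m v^T) = mxdot u (M *m v).
Proof. by rewrite /mxdot mulmxA mxtrace_mulC -mxtrace_tr !trmx_mul !trmxK mulmxA. Qed.

End MatrixInner.

(** * Spectral theorem for real symmetric matrices *)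

Section Spectral.
Context {R : realType} {n : nat}.
Implicit Types (Z : 'M[R]_n) (u v : 'cV[R]_n).

(** Fewer than n linear equations in n unknowns have a nonzero solution. *)
Lemma exists_unit_orthogonal k (v : nat -> 'cV[R]_n) : (k < n)%N ->
  exists u, mxdot u u = 1 /\ forall i, (i < k)%N -> mxdot (v i) u = 0.
Proof.
move=> kn; pose V : 'M[R]_(n, k) := \matrix_(i, j) v j i 0.
have : kermx V != 0.
  by rewrite -mxrank_eq0 mxrank_ker -lt0n subn_gt0 (leq_ltn_trans (rank_leq_col V)).
case/rowV0Pn => x /sub_kermxP xV x0.
have xp : 0 < mxdot x^T x^T.
  rewrite lt_neqAle mxdot_ge0 andbT eq_sym; apply: contra x0 => /eqP /mxdot_eq0 x0.
  by rewrite -(trmxK x) x0 trmx0.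
exists ((mxnorm x^T)^-1 *: x^T); split=> [|i ik].
  rewrite mxdotZl mxdotZr -mxnorm_sqr expr2 mulKf ?mulVf // gt_eqF //.
    by rewrite -(@ltr_pXn2r _ 2) ?nnegrE ?mxnorm_ge0 // expr0n /= mxnorm_sqr.
  by rewrite -(@ltr_pXn2r _ 2) ?nnegrE ?mxnorm_ge0 // expr0n /= mxnorm_sqr.
rewrite mxdotZr; have /matrixP /(_ 0 (Ordinal ik)) := xV; rewrite !mxE => xv.
rewrite mxdotE (eq_bigr (fun j => x 0 j * V j (Ordinal ik))) ?xv ?mulr0 // => j _.
by rewrite big_ord1 !mxE mulrC.
Qed.

Lemma form_continuous Z (w : 'cV[R]_n) :
  continuous (fun x : 'rV[R]_n => mxdot x^T (Z *m x^T)) /\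
  continuous (fun x : 'rV[R]_n => mxdot w x^T).
Proof.
have sumc (f : 'I_n -> 'rV[R]_n -> R) : (forall i, continuous (f i)) ->
    continuous (fun x : 'rV[R]_n => \sum_i f i x).
  by move=> fc; apply: continuous_big => //; exact: add_continuous.
have cc (i : 'I_n) : continuous (fun x : 'rV[R]_n => x 0 i) by exact: coord_continuous.
split.
  have -> : (fun x : 'rV[R]_n => mxdot x^T (Z *m x^T)) =
      (fun x => \sum_i \sum_j (x 0 i * (Z i j * x 0 j))).
    apply/funext => x; rewrite mxdotE; apply: eq_bigr => i _.
    rewrite big_ord1 !mxE mulr_sumr; apply: eq_bigr => j _; by rewrite !mxE.
  apply: (sumc) => i; apply: (sumc) => j x.
  have h := continuousM (@cst_continuous _ _ (Z i j) x) (cc j x).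
  exact: (continuousM (cc i x) h).
have -> : (fun x : 'rV[R]_n => mxdot w x^T) = (fun x => \sum_i w i 0 * x 0 i).
  by apply/funext => x; rewrite mxdotE; apply: eq_bigr => i _; rewrite big_ord1 !mxE.
by apply: (sumc) => i x; exact: (continuousM (@cst_continuous _ _ (w i 0) x) (cc i x)).
Qed.

(** The Rayleigh quotient attains its maximum on the compact set of unit vectors
orthogonal to v 0, ..., v (k - 1); homogeneity removes the normalization. *)
Lemma form_max Z k (v : nat -> 'cV[R]_n) : (k < n)%N ->
  exists u, [/\ mxdot u u = 1, forall i, (i < k)%N -> mxdot (v i) u = 0 &
    forall y, (forall i, (i < k)%N -> mxdot (v i) y = 0) ->
      mxdot y (Z *m y) <= mxdot u (Z *m u) * mxdot y y].
Proof.
move=> kn; pose A := [set x : 'rV[R]_n | mxdot x^T x^T = 1] `&`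
  \bigcap_(i in [set i | (i < k)%N]) [set x : 'rV[R]_n | mxdot (v i) x^T = 0].
have A0 : A !=set0.
  have [u [u1 uv]] := exists_unit_orthogonal v kn.
  by exists u^T; split=> [|i /= ik] /=; rewrite trmxK ?uv.
have c1 : continuous (fun x : 'rV[R]_n => mxdot x^T x^T).
  by have := (form_continuous 1%:M 0).1; under eq_fun do rewrite mul1mx.
have cA : compact A.
  apply: bounded_closed_compact.
    exists 1; split=> [|M M1 x [/= x1 _]]; first exact: num_real.
    rewrite /Num.norm /= mx_normrE; apply: bigmax_le => [|[i j] _ /=]; first exact: ltW (lt_trans _ M1).
    apply: le_trans (ltW M1); rewrite -(@ler_pXn2r _ 2) ?nnegrE // expr1n -x1 -mxnorm_sqr.
    rewrite ler_pXn2r ?nnegrE ?mxnorm_ge0 //.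
    by have := mx_coef_le_mxnorm x^T j i; rewrite mxE.
  apply: closedI.
    apply: (@preimage_closed _ _ (fun x : 'rV[R]_n => mxdot x^T x^T) [set x | x = 1]).
      by move=> x _; exact: c1.
    exact: closed_eq.
  apply: closed_bigI => i _.
  apply: (@preimage_closed _ _ (fun x : 'rV[R]_n => mxdot (v i) x^T) [set x | x = 0]).
    by move=> x _; exact: (form_continuous 0 (v i)).2.
  exact: closed_eq.
have cq : {within A, continuous (fun x : 'rV[R]_n => mxdot x^T (Z *m x^T))}.
  by apply: continuous_subspaceT; exact: (form_continuous Z 0).1.
have [c] := EVT_max_rV A0 cA cq; rewrite inE => -[/= c1' cv] cmax.
exists c^T; split=> // y yv.
have [->|y0] := eqVneq y 0; first by rewrite mulmx0 !mxdot0r mulr0.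
have yp : 0 < mxnorm y.
  rewrite lt_neqAle mxnorm_ge0 andbT eq_sym; apply: contra y0 => /eqP y0.
  by apply/eqP/mxdot_eq0; rewrite -mxnorm_sqr y0 expr0n.
have := cmax ((mxnorm y)^-1 *: y)^T; rewrite trmxK inE -scalemxAr !mxdotZl !mxdotZr.
rewrite -!mxnorm_sqr => H.
have yn : mxnorm y != 0 by rewrite gt_eqF.
have : (mxnorm y)^-1 * ((mxnorm y)^-1 * mxdot y (Z *m y)) <= mxdot c^T (Z *m c^T).
  apply: H; split=> [|i ik] /=; rewrite trmxK.
    by rewrite mxdotZl mxdotZr -mxnorm_sqr; field.
  by rewrite mxdotZr yv // mulr0.
by rewrite mulrA -invfM -expr2 mulrC ler_pdivrMr // exprn_gt0.
Qed.

(** The maximizer u of [form_max] is an eigenvector: the vector w = Z u - lam u is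
orthogonal to the previous eigenvectors, so the form lam |y|^2 - (y, Z y) is
nonnegative on the span of u and w.  It vanishes at u and its mixed term at (u, w)
is - |w|^2, hence w = 0.  Taking maxima over decreasing subspaces sorts the
eigenvalues. *)
Lemma spectral_family Z k : Z^T = Z -> (k <= n)%N ->
  exists (v : nat -> 'cV[R]_n) (l : nat -> R),
  [/\ forall i j, (i < k)%N -> (j < k)%N -> mxdot (v i) (v j) = (i == j)%:R,
      forall i, (i < k)%N -> Z *m v i = l i *: v i &
      forall i y, (i < k)%N -> (forall j, (j < i)%N -> mxdot (v j) y = 0) ->
        mxdot y (Z *m y) <= l i * mxdot y y].
Proof.
move=> Zs; elim: k => [_|k IH kn]; first by exists (fun=> 0), (fun=> 0).
have [v [l [vo vZ vm]]] := IH (ltnW kn).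
have [u [u1 uv um]] := form_max Z v kn.
set lam := mxdot u (Z *m u) in um.
have Zu : Z *m u = lam *: u.
  apply/eqP; rewrite -subr_eq0; apply/eqP/mxdot_eq0; set w := _ - _.
  have wE : w = Z *m u - lam *: u by [].
  clearbody w.
  have wv i : (i < k)%N -> mxdot (v i) w = 0.
    by move=> ik; rewrite wE !mxdotBE uv // mulr0 subr0 mxdotMr Zs vZ // mxdotZl uv // mulr0.
  have uw : mxdot u w = 0 by rewrite wE !mxdotBE u1 mulr1 subrr.
  have wZu : mxdot w (Z *m u) = mxdot w w.
    by rewrite {3}wE !mxdotBE (mxdotC w u) uw mulr0 subr0.
  have c0 : 0 <= lam * mxdot w w - mxdot w (Z *m w) by rewrite subr_ge0; exact: (um w wv).
  have := @quadratic_ge0_discr _ 0 (- mxdot w w) _ c0.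
  have H t : 0 <= 0 + 2 * t * - mxdot w w + t ^+ 2 * (lam * mxdot w w - mxdot w (Z *m w)).
    have := um (u + t *: w); rewrite -subr_ge0.
    have uZw : mxdot u (Z *m w) = mxdot w w by rewrite mxdotMr Zs mxdotC.
    rewrite mulmxDr -scalemxAr !mxdotBE (mxdotC w u) uw u1 wZu uZw -/lam => H.
    apply: le_trans (H _) _ => [i ik|]; first by rewrite !mxdotBE uv // wv // mulr0 addr0.
    by rewrite le_eqVlt; apply/orP; left; apply/eqP; ring.
  move=> /(_ H); rewrite mul0r sqrrN => H0.
  by apply/eqP; rewrite -sqrf_eq0 eq_le H0 sqr_ge0.
exists (fun j => if j == k then u else v j), (fun j => if j == k then lam else l j).
split=> [i j|i|i y].
- rewrite !ltnS => ik jk; have [ei|ik'] := eqVneq i k; have [ej|jk'] := eqVneq j k.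
  + by rewrite ei ej eqxx u1.
  + by rewrite ei eq_sym (negbTE jk') mxdotC uv // ltn_neqAle jk'.
  + by rewrite ej (negbTE ik') uv // ltn_neqAle ik'.
  + by apply: vo; rewrite ltn_neqAle ?ik' ?jk'.
- by rewrite ltnS leq_eqVlt; have [-> //|ik' /= ik] := eqVneq i k; exact: vZ.
- rewrite ltnS leq_eqVlt; have [-> /= _ H|ik' /= ik H] := eqVneq i k.
    by apply: um => j jk; have := H j jk; rewrite ltn_eqF.
  apply: vm => // j ji; have := H j ji.
  by rewrite ltn_eqF // (ltn_trans ji).
Qed.

Lemma symmetric_spectral Z : Z^T = Z -> exists (P : 'M[R]_n) (l : 'rV[R]_n),
  [/\ P^T *m P = 1%:M, forall i j : 'I_n, (i <= j)%N -> l 0 j <= l 0 i &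
      Z = P *m diag_mx l *m P^T].
Proof.
move=> Zs; have [v [l [vo vZ vm]]] := spectral_family Zs (leqnn n).
pose P : 'M[R]_n := \matrix_(i, j) v j i 0.
have PP : P^T *m P = 1%:M.
  apply/matrixP => i j; rewrite !mxE; have := vo i j (ltn_ord i) (ltn_ord j).
  rewrite mxdotE (inj_eq val_inj) => <-.
  by apply: eq_bigr => k _; rewrite big_ord1 !mxE.
have ZP : Z *m P = P *m diag_mx (\row_j l j).
  apply/matrixP => i j; rewrite mul_mx_diag !mxE mulrC.
  have /matrixP /(_ i 0) := vZ j (ltn_ord j); rewrite !mxE => <-.
  by apply: eq_bigr => k _; rewrite !mxE.
exists P, (\row_j l j); split=> // [i j ij|].
  rewrite !mxE; have := vm i (v j) (ltn_ord i).
  have H k : (k < i)%N -> mxdot (v k) (v j) = 0.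
    move=> ki; rewrite vo ?ltn_ord //; last exact: ltn_trans ki (ltn_ord i).
    by rewrite ltn_eqF // (leq_trans ki).
  by move=> /(_ H); rewrite vZ // mxdotZr vo // eqxx !mulr1.
by rewrite -ZP -mulmxA (mulmx1C PP) mulmx1.
Qed.

End Spectral.

(** * Second-order perturbation of a positive semidefinite matrix *)

Section PsdPerturbation.
Context {R : realType}.

(** In [psd_perturbation] the numbers a, e and b are the norms of the components of
a vector in the range of X, in its kernel and in the beta space, and Q is what
replaces a once the square is completed.  The three terms lam Q^2, s b^2 / 2 and
s^2 eta e^2 absorb the others as s tends to 0. *)
Lemma quadratic_dominance (lam eta C C0 : R) : 0 < lam -> 0 < eta -> 0 < C -> 0 <= C0 ->
  exists2 s0 : R, 0 < s0 & forall s Q a e b : R, 0 < s < s0 ->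
    0 <= Q -> 0 <= a -> 0 <= e -> 0 <= b -> a <= Q + s * C * e ->
    0 <= lam * Q ^+ 2 - s * (C * a ^+ 2) + s * (b ^+ 2 / 2)
         + s ^+ 2 * (eta * e ^+ 2 - C0 * b * e) - s ^+ 2 * (C * a ^+ 2)
         - 2 * s ^+ 2 * (C * a * e).
Proof.
move=> lam0 eta0 C0' C00; pose K := 4 * C ^+ 3 + C + 2 * C ^+ 2 + C0 ^+ 2 / 2.
have K0 : 0 < K.
  have : 0 < C ^+ 3 by rewrite exprn_gt0.
  have : 0 < C ^+ 2 by rewrite exprn_gt0.
  have : 0 <= C0 ^+ 2 by rewrite sqr_ge0.
  rewrite /K; lra.
exists (Num.min 1 (Num.min (lam / (5 * C)) (eta / K))).
  by rewrite !lt_min ltr01 !divr_gt0 // mulr_gt0.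
move=> s Q a e b; rewrite !lt_min ltr_pdivlMr ?mulr_gt0 // ltr_pdivlMr //.
move=> /and4P[s0 s1 sl sK] Q0 a0 e0 b0 aQ.
have s0' := ltW s0; have C0'' := ltW C0'.
have A1 : a ^+ 2 <= 2 * Q ^+ 2 + 2 * (s * C * e) ^+ 2.
  have : a ^+ 2 <= (Q + s * C * e) ^+ 2.
    by rewrite ler_pXn2r ?nnegrE // addr_ge0 // !mulr_ge0.
  have : 0 <= (Q - s * C * e) ^+ 2 by rewrite sqr_ge0.
  rewrite sqrrB sqrrD; lra.
have A2 : a * e <= Q * e + s * C * e * e by rewrite -mulrDl ler_wpM2r.
have s2 : s ^+ 2 <= s by rewrite expr2 ler_piMr // ltW.
have B1 : s * (C * a ^+ 2) <= s * (C * (2 * Q ^+ 2 + 2 * (s * C * e) ^+ 2)).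
  by rewrite ler_wpM2l // ler_wpM2l.
have B2 : s ^+ 2 * (C * a ^+ 2) <= s * (C * (2 * Q ^+ 2 + 2 * (s * C * e) ^+ 2)).
  by apply: le_trans B1; rewrite ler_wpM2r // mulr_ge0 ?sqr_ge0.
have B3 : 2 * s ^+ 2 * (C * a * e) <= 2 * s ^+ 2 * (C * (Q * e + s * C * e * e)).
  by rewrite -[C * a * e]mulrA; apply: ler_wpM2l; [rewrite mulr_ge0 ?sqr_ge0|exact: ler_wpM2l].
have B4 : 0 <= s * (C * (Q - s * e) ^+ 2) by do 2!apply: mulr_ge0 => //; exact: sqr_ge0.
have B5 : 0 <= s / 2 * (b - s * C0 * e) ^+ 2 by apply: mulr_ge0; [exact: divr_ge0|exact: sqr_ge0].
have B6 : 0 <= Q ^+ 2 * (lam - s * (5 * C)) by apply: mulr_ge0; [exact: sqr_ge0|rewrite subr_ge0 ltW].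
have B7 : 0 <= s ^+ 2 * e ^+ 2 * (eta - s * K).
  by apply: mulr_ge0; [apply: mulr_ge0; exact: sqr_ge0|rewrite subr_ge0 ltW].
move: B1 B2 B3 B4 B5 B6 B7; rewrite /K; lra.
Qed.

(** The Moore-Penrose inverse of a symmetric matrix; symmetry of [Y] and
commutation make [X *m Y] the orthogonal projector onto the range of [X]. *)
Definition pseudo_inverse n (X Y : 'M[R]_n) :=
  [/\ Y^T = Y, X *m Y = Y *m X, X *m Y *m X = X & Y *m X *m Y = Y].

Lemma pseudo_inverse_ex n (X : 'M[R]_n) : X^T = X -> exists Y, pseudo_inverse X Y.
Proof.
move=> /symmetric_spectral [P [l [PP _ XE]]].
pose k : 'rV[R]_n := \row_j (l 0 j)^-1.
exists (P *m diag_mx k *m P^T).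
have dd (a b : 'rV[R]_n) : (P *m diag_mx a *m P^T) *m (P *m diag_mx b *m P^T) =
    P *m diag_mx (\row_j (a 0 j * b 0 j)) *m P^T.
  rewrite !mulmxA -(mulmxA _ P^T) PP mulmx1; congr (_ *m _).
  by rewrite -mulmxA mulmx_diag.
split.
- by rewrite !trmx_mul trmxK tr_diag_mx mulmxA.
- rewrite XE !dd; congr (_ *m diag_mx _ *m _); apply/rowP => j.
  by rewrite !mxE mulrC.
- rewrite XE !dd; congr (_ *m diag_mx _ *m _); apply/rowP => j; rewrite !mxE.
  by have [->|l0] := eqVneq (l 0 j) 0; rewrite ?mulr0 // mulfV // mul1r.
- rewrite XE !dd; congr (_ *m diag_mx _ *m _); apply/rowP => j; rewrite !mxE.
  by have [->|l0] := eqVneq (l 0 j) 0; rewrite ?invr0 ?mulr0 // mulVf // mul1r.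
Qed.

Section Fixed.
Variables (n : nat) (X Y : 'M[R]_n).
Hypotheses (Xpsd : psd X) (XY : pseudo_inverse X Y).
Local Notation E := (1%:M - X *m Y).

Lemma psd_sym : X^T = X. Proof. by case: Xpsd => /symmP. Qed.

Lemma kernel_projectorP : [/\ E^T = E, E *m E = E, X *m E = 0, E *m X = 0 & Y *m E = 0].
Proof.
have [Yt XYC XYX YXY] := XY; split.
- by rewrite linearB /= trmx1 trmx_mul Yt psd_sym XYC.
- by rewrite mulmxBr mulmx1 mulmxBl mul1mx mulmxA XYX subrr subr0.
- by rewrite mulmxBr mulmx1 XYC mulmxA XYX subrr.
- by rewrite mulmxBl mul1mx XYX subrr.
- by rewrite mulmxBr mulmx1 mulmxA YXY subrr.
Qed.

(** Cauchy-Schwarz for the form of [X], applied to u and w = Y u: since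
(u, X w) = |u|^2, it gives |u|^4 <= (u, X u) (u, Y u), and (u, Y u) is at most
C |u|^2. *)
Lemma psd_coercive_on_range : exists2 lam : R, 0 < lam &
  forall u : 'cV[R]_n, X *m Y *m u = u -> lam * mxdot u u <= mxdot u (X *m u).
Proof.
have [Yt XYC XYX YXY] := XY; have [C C0 HC] := mx_form_bound Y.
exists C^-1 => [|u uE]; first by rewrite invr_gt0.
have [->|u0] := eqVneq u 0; first by rewrite mulmx0 mxdot0r mulr0.
have up : 0 < mxdot u u.
  rewrite lt_neqAle mxdot_ge0 andbT eq_sym; apply: contra u0 => /eqP ?.
  exact/eqP/mxdot_eq0.
rewrite mulrC ler_pdivrMr //; set w := Y *m u.
have uw : mxdot u (X *m w) = mxdot u u by rewrite /w mulmxA uE.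
have ww : mxdot w (X *m w) <= C * mxdot u u.
  rewrite /w [X *m _]mulmxA uE mxdotC -mxnorm_sqr expr2 mulrA.
  exact: le_trans (ler_norm _) (HC u u).
have : mxdot u u ^+ 2 <= mxdot u (X *m u) * mxdot w (X *m w).
  have [_ Xp] := Xpsd; apply: quadratic_ge0_discr => // t.
  have := Xp (u + t *: w); rewrite mulmxDr -scalemxAr !mxdotBE uw.
  have -> : mxdot w (X *m u) = mxdot u u by rewrite mxdotMr psd_sym mxdotC.
  move=> H.
  by apply: le_trans H _; rewrite le_eqVlt; apply/orP; left; apply/eqP; ring.
move=> H; rewrite -(ler_pM2r up) -expr2; apply: le_trans H _.
by rewrite -mulrA ler_wpM2l //; case: Xpsd => _; exact.
Qed.

(** For u = a + e with a in the range and e in the kernel of [X], completing the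
square in the range leaves on the kernel the Schur complement
s (e, M e) + s^2 ((e, N e) - (M e, Y M e)).  The two hypotheses on M and N bound
its terms from below; the remainders are of order s^3. *)
Lemma psd_perturbation (M N Bp : 'M[R]_n) (eta C0 : R) : M^T = M -> N^T = N ->
  0 < eta -> 0 <= C0 ->
  (forall e : 'cV[R]_n, E *m e = e ->
     mxdot (Bp *m e) (Bp *m e) / 2 <= mxdot e (M *m e)) ->
  (forall e : 'cV[R]_n, E *m e = e ->
     eta * mxdot e e - C0 * mxnorm (Bp *m e) * mxnorm e <=
     mxdot e (N *m e) - mxdot (M *m e) (Y *m (M *m e))) ->
  exists2 s0 : R, 0 < s0 & forall s, 0 < s < s0 -> psd (X + s *: M + s ^+ 2 *: N).
Proof.
move=> Mt Nt eta0 C00 HM HN.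
have [Yt XYC XYX YXY] := XY; have [Et EE XE EX YE] := kernel_projectorP.
have [lam lam0 Hlam] := psd_coercive_on_range.
have [CM CM0 HCM] := mx_form_bound M.
have [CN CN0 HCN] := mx_form_bound N.
have [CY CY0 HCY] := mx_form_bound (Y *m M).
pose C := CM + CN + CY.
have C0p : 0 < C by rewrite !addr_gt0.
have [s0 s00 Hs] := quadratic_dominance lam0 eta0 C0p C00.
exists s0 => // s s0s; have /andP[sp _] := s0s; split=> [|u].
  by apply/symmP; rewrite !linearD /= !linearZ /= psd_sym Mt Nt.
pose e := E *m u; pose a := X *m Y *m u; pose q := a + s *: (Y *m (M *m e)).
have uE : u = a + e by rewrite /a /e mulmxBl mul1mx addrC subrK.
have Ee : E *m e = e by rewrite /e mulmxA EE.
have Xe : X *m e = 0 by rewrite /e mulmxA XE mul0mx.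
have Pa : X *m Y *m a = a by rewrite /a mulmxA [X *m Y *m _]mulmxA XYX.
have Pq : X *m Y *m q = q.
  by rewrite /q mulmxDr Pa -scalemxAr; congr (_ + _ *: _); rewrite [LHS]mulmxA XYC YXY.
have nY : mxnorm (Y *m (M *m e)) <= C * mxnorm e.
  have [->|y0] := eqVneq (mxnorm (Y *m (M *m e))) 0.
    by rewrite mulr_ge0 ?mxnorm_ge0 // ltW.
  have yp : 0 < mxnorm (Y *m (M *m e)) by rewrite lt_neqAle eq_sym y0 mxnorm_ge0.
  rewrite -(ler_pM2l yp) -expr2 mxnorm_sqr mulmxA.
  apply: le_trans (le_trans (ler_norm _) (HCY _ _)) _.
  rewrite [CY * _]mulrC -mulrA ler_wpM2l ?mxnorm_ge0 // ler_wpM2r ?mxnorm_ge0 //.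
  by rewrite /C lerDr addr_ge0 // ltW.
have na : mxnorm a <= mxnorm q + s * C * mxnorm e.
  have -> : a = q + (- s) *: (Y *m (M *m e)) by rewrite /q scaleNr addrK.
  apply: le_trans (mxnorm_triangle _ _) _.
  by rewrite lerD2l mxnormZ normrN gtr0_norm // -mulrA ler_pM2l.
have H1 : lam * mxnorm q ^+ 2 <= mxdot q (X *m q) by rewrite mxnorm_sqr Hlam.
have eaM : mxdot e (M *m a) = mxdot a (M *m e) by rewrite mxdotMr Mt mxdotC.
have eaN : mxdot e (N *m a) = mxdot a (N *m e) by rewrite mxdotMr Nt mxdotC.
have qE : mxdot q (X *m q) = mxdot a (X *m a) + 2 * s * mxdot a (M *m e)
    + s ^+ 2 * mxdot (M *m e) (Y *m (M *m e)).
  have h1 : mxdot (Y *m (M *m e)) (X *m a) = mxdot a (M *m e).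
    by rewrite mxdotMl Yt (mulmxA Y X a) -XYC Pa mxdotC.
  have h2 : mxdot a (X *m (Y *m (M *m e))) = mxdot a (M *m e).
    by rewrite mxdotMr psd_sym mxdotMr Yt (mulmxA Y X a) -XYC Pa.
  have h3 : mxdot (Y *m (M *m e)) (X *m (Y *m (M *m e))) = mxdot (M *m e) (Y *m (M *m e)).
    by rewrite mxdotMl Yt (mulmxA Y X _) (mulmxA (Y *m X) Y _) YXY.
  rewrite /q mulmxDr -scalemxAr !mxdotBE h1 h2 h3; ring.
have uZ : mxdot u ((X + s *: M + s ^+ 2 *: N) *m u) =
    mxdot q (X *m q) + s * mxdot a (M *m a) + s * mxdot e (M *m e)
    + s ^+ 2 * (mxdot e (N *m e) - mxdot (M *m e) (Y *m (M *m e)))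
    + s ^+ 2 * mxdot a (N *m a) + 2 * s ^+ 2 * mxdot a (N *m e).
  rewrite qE uE !mulmxDl -!scalemxAl !mulmxDr Xe addr0 !mxdotBE eaM eaN.
  have -> : mxdot e (X *m a) = 0 by rewrite mxdotMr psd_sym Xe mxdot0l.
  ring.
have H2 : - (C * mxnorm a ^+ 2) <= mxdot a (M *m a).
  have := HCM a a; rewrite ler_norml => /andP[+ _]; apply: le_trans.
  rewrite lerN2 -mulrA -expr2 ler_wpM2r ?sqr_ge0 // /C -addrA lerDl addr_ge0 // ltW //.
have H3 : - (C * mxnorm a ^+ 2) <= mxdot a (N *m a).
  have := HCN a a; rewrite ler_norml => /andP[+ _]; apply: le_trans.
  rewrite lerN2 -mulrA -expr2 ler_wpM2r ?sqr_ge0 // /C addrAC lerDr addr_ge0 // ltW //.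
have H4 : - (C * mxnorm a * mxnorm e) <= mxdot a (N *m e).
  have := HCN a e; rewrite ler_norml => /andP[+ _]; apply: le_trans.
  rewrite lerN2 -!mulrA ler_wpM2r ?mulr_ge0 ?mxnorm_ge0 // /C addrAC lerDr addr_ge0 // ltW //.
have H5 := HM e Ee; have H6 := HN e Ee; rewrite -!mxnorm_sqr in H5 H6.
have := Hs s (mxnorm q) (mxnorm a) (mxnorm e) (mxnorm (Bp *m e)) s0s
  (mxnorm_ge0 _) (mxnorm_ge0 _) (mxnorm_ge0 _) (mxnorm_ge0 _) na.
have s2p : 0 <= s ^+ 2 by rewrite sqr_ge0.
move/le_trans; apply; rewrite uZ.
have G1 := ler_wpM2l (ltW sp) H2; have G2 := ler_wpM2l s2p H3.
have G3 := ler_wpM2l s2p H4; have G4 := ler_wpM2l (ltW sp) H5.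
have G5 := ler_wpM2l s2p H6.
move: H1 G1 G2 G3 G4 G5.
lra.
Qed.

End Fixed.
End PsdPerturbation.

(** * Normal cones of the positive semidefinite cone *)

Section NormalCone.
Context {R : realType} {n : nat}.
Implicit Types (X S V M A K : 'M[R]_n).

Lemma psd_factor X : psd X -> exists K : 'M[R]_n, X = K *m K^T.
Proof.
move=> [/symmP Xt Xp]; have [P [l [PP _ XE]]] := symmetric_spectral Xt.
have l0 j : 0 <= l 0 j.
  have := Xp (P *m delta_mx j 0); rewrite mxdotMl XE !mulmxA PP mul1mx.
  rewrite -[_ *m P^T *m P]mulmxA PP mulmx1 mxdotE (bigD1 j) //= big_ord1.
  rewrite big1 ?addr0 => [|i ij]; last by rewrite big_ord1 mxE (negbTE ij) mul0r.
  rewrite mul_diag_mx !mxE !eqxx mul1r mulr1; apply.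
pose k : 'rV[R]_n := \row_j Num.sqrt (l 0 j).
exists (P *m diag_mx k); rewrite trmx_mul tr_diag_mx mulmxA -[P *m _ *m diag_mx k]mulmxA.
rewrite mulmx_diag {1}XE; congr (_ *m diag_mx _ *m _); apply/rowP => j.
by rewrite !mxE -expr2 sqr_sqrtr.
Qed.

(** A positive semidefinite matrix is a sum of matrices u u^T. *)
Lemma mxdot_nsd_psd_le0 V A : (forall u : 'cV[R]_n, mxdot u (V *m u) <= 0) ->
  psd A -> mxdot V A <= 0.
Proof.
move=> Vn /psd_factor [K ->].
have -> : K *m K^T = \sum_j col j K *m (col j K)^T.
  apply/matrixP => i k; rewrite summxE !mxE; apply: eq_bigr => j _.
  by rewrite !mxE big_ord1 !mxE.
rewrite mxdotC mxdot_sum_l; apply: sumr_le0 => j _.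
by rewrite mxdotC mxdot_outer.
Qed.

Lemma mxdot_mulmxr m (U : 'M[R]_(m, n)) (A : 'M[R]_n) (V : 'M[R]_(m, n)) :
  mxdot (U *m A) V = mxdot U (V *m A^T).
Proof. by rewrite /mxdot trmx_mul -mulmxA mxtrace_mulC mulmxA. Qed.

Lemma psd_congr A K : psd A -> psd (K *m A *m K^T).
Proof.
move=> [/symmP At Ap]; split; first by apply/symmP; rewrite !trmx_mul trmxK At mulmxA.
by move=> u; rewrite -!mulmxA mxdotMr; apply: Ap.
Qed.

Lemma psdD X M : psd X -> psd M -> psd (X + M).
Proof.
move=> [/symmP Xt Xp] [/symmP Mt Mp]; split; first by apply/symmP; rewrite linearD /= Xt Mt.
by move=> u; rewrite mulmxDl mxdotDr addr_ge0.
Qed.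

(** Testing normality on (1 + t K) X (1 + t K)^T with K = S X makes the linear term
in t equal to 2 |S X|^2; it must vanish because t takes both signs. *)
Lemma normal_psdP X S : psd X -> normal_psd X S ->
  [/\ S^T = S, (forall u : 'cV[R]_n, mxdot u (S *m u) <= 0), X *m S = 0 & S *m X = 0].
Proof.
move=> Xpsd [/symmP St SN]; have [/symmP Xt Xp] := Xpsd.
have Sn A : psd A -> mxdot S A <= 0.
  by move=> Ap; have := SN _ (psdD Xpsd Ap); rewrite [X + A]addrC addrK.
have Sn' (u : 'cV[R]_n) : mxdot u (S *m u) <= 0.
  rewrite -mxdot_outer; apply: Sn; split.
    by apply/symmP; rewrite trmx_mul trmxK.
  by move=> w; rewrite -mulmxA mxdotMr mxdot_ge0.
have SX : S *m X = 0.
  pose K := S *m X; have Kt : K^T = X *m S by rewrite trmx_mul Xt St.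
  have c0 : 0 <= - mxdot S (K *m X *m K^T) by rewrite oppr_ge0 Sn //; exact: psd_congr.
  have := @quadratic_ge0_discr _ 0 (- mxdot K K) _ c0.
  have H t : 0 <= 0 + 2 * t * - mxdot K K + t ^+ 2 * - mxdot S (K *m X *m K^T).
    have := SN _ (psd_congr (1%:M + t *: K) Xpsd).
    have -> : (1%:M + t *: K) *m X *m (1%:M + t *: K)^T - X =
        t *: (K *m X + X *m K^T) + t ^+ 2 *: (K *m X *m K^T).
      rewrite linearD linearZ /= trmx1 mulmxDl mul1mx mulmxDr mulmx1 mulmxDl.
      rewrite -!scalemxAl -!scalemxAr scalerA -expr2 scalerDr.
      by rewrite addrC !addrA addNr add0r.
    have h1 : mxdot S (K *m X) = mxdot K K by rewrite mxdotC mxdot_mulmxr Xt mxdotC.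
    have h2 : mxdot S (X *m K^T) = mxdot K K.
      by rewrite -h1 /mxdot -mxtrace_tr !trmx_mul !trmxK Xt St mxtrace_mulC.
    rewrite !mxdotBE h1 h2 => H; rewrite -oppr_le0; apply: le_trans H.
    by rewrite le_eqVlt; apply/orP; left; apply/eqP; ring.
  move=> /(_ H); rewrite mul0r sqrrN => H0; apply: mxdot_eq0.
  by apply/eqP; rewrite -sqrf_eq0 eq_le H0 sqr_ge0.
by split=> //; rewrite -[X]Xt -[S]St -trmx_mul SX trmx0.
Qed.

Lemma normal_psdI X V : V^T = V -> (forall u : 'cV[R]_n, mxdot u (V *m u) <= 0) ->
  V *m X = 0 -> normal_psd X V.
Proof.
move=> Vt Vn VX; split; first exact/symmP.
move=> A Ap; rewrite mxdotDr mxdotNr.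
by rewrite [mxdot V X]/mxdot Vt VX mxtrace0 subr0 mxdot_nsd_psd_le0.
Qed.

(** With E the projector onto the kernel of [X] and C large, [M - C *: E] and
[- (C *: E)] are both normal, and [M] is their difference. *)
Lemma Sp_normal_psd X M : psd X -> M^T = M -> M *m X = 0 -> Sp (normal_psd X) M.
Proof.
move=> Xp Mt MX; have [Y XY] := pseudo_inverse_ex (psd_sym Xp).
have [Et EE XE EX YE] := kernel_projectorP Xp XY; set E := 1%:M - _ in Et EE XE EX YE.
have [C C0 HC] := mx_form_bound M.
have ME : M *m E = M by rewrite mulmxBr mulmx1 mulmxA MX mul0mx subr0.
have EM : E *m M = M by rewrite -{1}Mt -[E]Et -trmx_mul ME Mt.
have EP (u : 'cV[R]_n) : mxdot u (E *m u) = mxdot (E *m u) (E *m u).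
  by rewrite [RHS]mxdotMl Et mulmxA EE.
exists 1, (M - C *: E), (- (C *: E)); split=> //; last by rewrite scale1r opprK subrK.
  apply: normal_psdI; first by rewrite linearB linearZ /= Mt Et.
    move=> u; rewrite mulmxBl -scalemxAl !mxdotBE subr_le0 EP.
    have -> : mxdot u (M *m u) = mxdot (E *m u) (M *m (E *m u)).
      by rewrite mxdotMl Et !mulmxA EM ME.
    rewrite -mxnorm_sqr expr2 mulrA.
    exact: le_trans (ler_norm _) (HC _ _).
  by rewrite mulmxBl MX -scalemxAl EX scaler0 subr0.
apply: normal_psdI; first by rewrite linearN linearZ /= Et.
  move=> u; rewrite mulNmx -scalemxAl !mxdotBE EP oppr_le0 mulr_ge0 ?mxdot_ge0 //.
  exact: ltW.
by rewrite mulNmx -scalemxAl EX scaler0 oppr0.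
Qed.

End NormalCone.

(** * Adjoints and the Fredholm alternative *)

Section Adjoint.
Context {R : realType} {X : euclideanType R}.

Lemma adjE p q (L : {linear X -> 'M[R]_(p, q)}) Y h :
  inner (adj L Y) h = mxdot Y (L h).
Proof. by apply: rieszE => a u v; rewrite linearP mxdotDr mxdotZr. Qed.

Lemma adjD p q (L : {linear X -> 'M[R]_(p, q)}) Y Z : adj L (Y + Z) = adj L Y + adj L Z.
Proof. by apply: inner_inj => h; rewrite innerDl !adjE mxdotDl. Qed.

Lemma adjZ p q (L : {linear X -> 'M[R]_(p, q)}) a Y : adj L (a *: Y) = a *: adj L Y.
Proof. by apply: inner_inj => h; rewrite innerZl !adjE mxdotZl. Qed.

Lemma row_pairing m n (a : 'cV[R]_m) (V : 'M[R]_n) (c : 'cV[R]_(m + n * n)) :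
  (row_mx a^T (mxvec V) *m c) 0 0 =
  mxdot (usubmx c) a + mxdot (vec_mx (dsubmx c)^T) V.
Proof.
rewrite -{1}[c]vsubmxK mul_row_col mxE; congr (_ + _).
  rewrite mxdotE mxE; apply: eq_bigr => i _.
  by rewrite big_ord1 !mxE mulrC.
rewrite mxdotE mxE pair_bigA /= (reindex _ (curry_mxvec_bij _ _)) /=.
by apply: eq_bigr => -[i j] _ /=; rewrite mxvecE !mxE mulrC.
Qed.

(** If (0, M0) is not in the range of d |-> (A d, T d), a linear form that vanishes
on the range separates it; in coordinates this form is a column of the cokernel
matrix. *)
Lemma fredholm m n (A : {linear X -> 'cV[R]_m}) (T : X -> 'M[R]_n) (M0 : 'M[R]_n) :
  linear T ->
  (forall (y : 'cV[R]_m) (U : 'M[R]_n), (forall d, mxdot y (A d) + mxdot U (T d) = 0) ->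
     mxdot U M0 = 0) ->
  exists d, A d = 0 /\ T d = M0.
Proof.
move=> Tlin H; have [e [eo ex]] := @orthonormal_basis R X.
pose f d := row_mx (A d)^T (mxvec (T d)).
have flin : linear f.
  move=> a u v; rewrite /f Tlin linearP /= linearP /= linearP /=.
  by rewrite scale_row_mx add_row_mx.
pose fL := GRing.isLinear.Build _ _ _ _ _ flin.
pose g : {linear X -> 'rV[R]_(m + n * n)} := HB.pack f fL.
pose F := \matrix_(i < \dim {: X}) f (e i).
have fE (D : 'rV[R]_(\dim {: X})) : f (\sum_i D 0 i *: e i) = D *m F.
  have gE x : f x = g x by [].
  rewrite mulmx_sum_row gE linear_sum; apply: eq_bigr => i _.
  by rewrite rowK linearZ.
pose r0 := row_mx (0 : 'cV[R]_m)^T (mxvec M0).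
have [/submxP [D DE]|] := boolP (r0 <= F)%MS.
  exists (\sum_i D 0 i *: e i); have := fE D; rewrite -DE => /eq_row_mx [h1 h2].
  split; first by apply: trmx_inj; rewrite h1.
  by have := congr1 vec_mx h2; rewrite !mxvecK.
rewrite submxE => /rV0Pn [k rk]; pose c := col k (cokermx F).
have r0c : (r0 *m c) 0 0 != 0 by rewrite /c colE mulmxA -colE mxE.
have := H (usubmx c) (vec_mx (dsubmx c)^T) => H0.
move: r0c; rewrite row_pairing mxdot0r add0r H0 ?eqxx // => d.
rewrite -row_pairing -/(f d) (ex d).
have -> : \sum_i inner (e i) d *: e i =
    \sum_i (\row_i inner (e i) d) 0 i *: e i by apply: eq_bigr => i _; rewrite mxE.
by rewrite fE /c colE -mulmxA (mulmxA F) mulmx_coker mul0mx mulmx0 mxE.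
Qed.

End Adjoint.

(** * Nondegeneracy and regularity of the constraint *)

Section Constraint.
Context {R : realType} {X : euclideanType R} {m n : nat}.
Variables (A : {linear X -> 'cV[R]_m}) (b : 'cV[R]_m)
  (B : {linear X -> 'M[R]_n}) (B0 : 'M[R]_n) (xs : X).
Hypotheses (Bsym : forall x, symm (B x))
  (feas : feasible A b B B0 xs).
Local Notation Xs := (gmap B B0 xs).

(** A linear form U that obstructs surjectivity compresses to a symmetric matrix
in the span of the normal cone whose image under [adj B] lies in the range of
[adj A]; condition (A) makes it zero. *)
Lemma nondegenerate_onto (Y M0 : 'M[R]_n) : pseudo_inverse Xs Y ->
  Sp (normal_psd Xs) `&` adj B @^-1` range (adj A) = [set 0] ->
  M0^T = M0 -> (1%:M - Xs *m Y) *m M0 *m (1%:M - Xs *m Y) = M0 ->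
  exists d, A d = 0 /\ (1%:M - Xs *m Y) *m B d *m (1%:M - Xs *m Y) = M0.
Proof.
move=> XY ND M0t M0E; have Xp : psd Xs by case: feas.
have [Et EE XE EX YE] := kernel_projectorP Xp XY; set E := 1%:M - _ in Et EE XE EX YE M0E *; clearbody E.
have Bt d : (B d)^T = B d by apply/symmP.
apply: fredholm => [a u v|y U H].
  by rewrite linearP /= mulmxDr mulmxDl -scalemxAr -scalemxAl.
have dotT (W : 'M[R]_n) : W^T = W -> mxdot U^T W = mxdot U W.
  by move=> Wt; rewrite /mxdot trmxK -mxtrace_tr trmx_mul Wt mxtrace_mulC.
(* Symmetrizing U doubles its pairing with symmetric matrices, hence the
   factor - 2 in the multiplier below. *)
pose M := E *m (U + U^T) *m E.
have MW W : W^T = W -> mxdot M W = 2 * mxdot U (E *m W *m E).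
  move=> Wt; rewrite /M mxdot_mulmxr mxdotMl Et mulmxA mxdotDl dotT; first by ring.
  by rewrite !trmx_mul Et Wt mulmxA.
have : (Sp (normal_psd Xs) `&` adj B @^-1` range (adj A)) M.
  split.
    apply: Sp_normal_psd => //; last by rewrite /M -[_ *m gmap _ _ _]mulmxA EX mulmx0.
    by rewrite /M !trmx_mul Et linearD /= trmxK [U^T + U]addrC mulmxA.
  exists (- 2 *: y) => //; apply: inner_inj => h; rewrite !adjE mxdotZl MW //.
  by have /eqP := H h; rewrite addrC addr_eq0 => /eqP ->; ring.
rewrite ND => /= M0'; have := MW _ M0t; rewrite M0' mxdot0l M0E => /esym /eqP.
by rewrite mulf_eq0 pnatr_eq0 /= => /eqP.
Qed.

(** Perturb the right-hand side of the constraint by - t S: regularity yields a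
point u with A u = b and g u + t S positive semidefinite.  Testing the
normality of S at this matrix leaves t |S|^2 <= 0, as the contribution of
u - xs is that of adj A y on the kernel of [A]. *)
Lemma regular_multiplier_zero (y : 'cV[R]_m) (S : 'M[R]_n) :
  Gmap_metrically_regular A b B B0 xs -> normal_psd Xs S ->
  adj A y + adj B S = 0 -> S = 0.
Proof.
move=> [F0 [delta [kappa [d0 k0 H]]]] NS yS.
have [Axs Xp] := feas.
have [St _ _ SX] := normal_psdP Xp NS.
pose t := delta / (1 + mxnorm S).
have S1 : 0 < 1 + mxnorm S by rewrite ltr_pwDl // mxnorm_ge0.
have t0 : 0 < t by rewrite divr_gt0.
have tS : t * mxnorm S <= delta.
  by rewrite /t mulrAC ler_pdivrMr // ler_pM2l // lerDr.
(* The factor t places this perturbation in the ball where regularity holds. *)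
pose Z : 'cV[R]_m * 'M[R]_n := (0, - (t *: S)).
have symZ : symm Z.2 by apply/symmP; rewrite linearN linearZ /= St.
have mxnorm0 p q : mxnorm (0 : 'M[R]_(p, q)) = 0 by rewrite /mxnorm mxdot0l sqrtr0.
have ballZ : closed_ball_ (pair_norm Num.norm (pair_norm (@mxnorm R m 1) (@mxnorm R n n)))
    (xs, 0) delta (xs, Z).
  rewrite /closed_ball_ /pair_norm /= !subrr normr0 mxnorm0 expr0n /= !add0r opprK.
  by rewrite !sqrtr_sqr normr_id ger0_norm ?mxnorm_ge0 // mxnormZ gtr0_norm.
have [u [V Vp [uA uB]]] : exists u, Gmap A b B B0 u Z.
  apply: contrapT => /forallNP noZ; have := H xs Z symZ ballZ.
  have -> : [set u | Gmap A b B B0 u Z] = set0 by apply/seteqP; split=> // u /noZ.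
  rewrite /dist image_set0 ereal_inf0; apply/negP; rewrite -ltNge.
  apply: (@le_lt_trans _ _ (kappa%:E * (pair_norm (@mxnorm R m 1) (@mxnorm R n n) (Z - 0))%:E)%E).
    rewrite lee_pmul2l //; apply: ereal_inf_lbound; by exists 0.
  by rewrite -EFinM ltry.
have {}uA : A u = b by apply/eqP; rewrite -subr_eq0 uA.
have VE : V = gmap B B0 u + t *: S by rewrite -[t *: S]opprK -uB opprB addrC subrK.
have [/symmP _ SN] := NS; have := SN V Vp; rewrite VE.
have -> : gmap B B0 u + t *: S - gmap B B0 xs = B (u - xs) + t *: S.
  have -> : B (u - xs) = B u - B xs by rewrite linearB.
  by rewrite addrAC /gmap opprB addrA subrK.
rewrite mxdotDr mxdotZr -adjE.
have -> : inner (adj B S) (u - xs) = 0.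
  have -> : adj B S = - adj A y by apply/eqP; rewrite -addr_eq0 addrC yS.
  by rewrite innerNl adjE linearB /= uA Axs subrr mxdot0r oppr0.
rewrite add0r pmulr_rle0 // => SS; apply: mxdot_eq0.
by apply/eqP; rewrite eq_le SS mxdot_ge0.
Qed.

End Constraint.

(** * Simultaneous ordered diagonalization *)

Section Eigenvalues.
Context {R : realType} {n : nat}.
Implicit Types (X S P : 'M[R]_n) (l : 'rV[R]_n).

Let nonincr l := forall i j : 'I_n, (i <= j)%N -> l 0 j <= l 0 i.

Lemma char_poly_orthodiag P l : P^T *m P = 1%:M ->
  char_poly (P *m diag_mx l *m P^T) = \prod_(i < n) ('X - (l 0 i)%:P).
Proof.
move=> PP.
have -> : char_poly (P *m diag_mx l *m P^T) = char_poly (diag_mx l).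
  rewrite /char_poly /char_poly_mx !map_mxM /=.
  set p := map_mx polyC P; set q := map_mx polyC P^T.
  have pq : p *m q = 1%:M by rewrite -map_mxM (mulmx1C PP) map_mx1.
  have qp : q *m p = 1%:M by rewrite -map_mxM PP map_mx1.
  have -> : 'X%:M - p *m map_mx polyC (diag_mx l) *m q =
      p *m ('X%:M - map_mx polyC (diag_mx l)) *m q.
    by rewrite mulmxBr mulmxBl scalar_mxC -[_%:M *m p *m q]mulmxA pq mulmx1.
  by rewrite !det_mulmx mulrAC -det_mulmx pq det1 mul1r.
rewrite char_poly_trig; last exact: diag_mx_is_trig.
by apply: eq_bigr => i _; rewrite mxE eqxx mulr1n.
Qed.

(** The product determines the values up to a permutation, and sorting makes the
permutation trivial. *)
Lemma nonincr_unique l l' : nonincr l -> nonincr l' ->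
  \prod_(i < n) ('X - (l 0 i)%:P) = \prod_(i < n) ('X - (l' 0 i)%:P) -> l = l'.
Proof.
move=> ls l's E.
pose t l : seq R := [seq l 0 i | i <- enum 'I_n].
have tsort l0 : nonincr l0 -> sorted (>=%O) (t l0).
  move=> ls0; rewrite sorted_map.
  have : sorted (fun i j : 'I_n => (i <= j)%N) (enum 'I_n).
    have : sorted leq (map val (enum 'I_n)) by rewrite val_enum_ord iota_sorted.
    by rewrite sorted_map.
  by apply: sub_sorted => i j; exact: ls0.
have pE : perm_eq (t l) (t l').
  have H l0 : \prod_(x <- t l0) ('X - x%:P) = \prod_(i < n) ('X - (l0 0 i)%:P).
    by rewrite /t (big_map (fun i => l0 0 i)) big_enum.
  by apply: prod_XsubC_eq; rewrite !H.
have tE : t l = t l'.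
  apply: (sorted_eq (leT := >=%O)) (tsort _ ls) (tsort _ l's) pE.
    by move=> x y z; exact: ge_trans.
  by move=> x y H; apply: le_anti; rewrite andbC; exact: H.
apply/rowP => i; have := congr1 (fun s => nth 0 s i) tE.
have H (l0 : 'rV[R]_n) : nth 0 (t l0) i = l0 0 i.
  by rewrite /t (nth_map i 0 (fun i => l0 0 i)) ?size_enum_ord // nth_ord_enum.
by rewrite !H.
Qed.

Lemma eigvals_orthodiag P l : P^T *m P = 1%:M -> nonincr l ->
  eigvals (P *m diag_mx l *m P^T) = l.
Proof.
move=> PP ls; rewrite /eigvals; case: xgetP => [l' _ [l's]|/(_ l) []].
  by rewrite char_poly_orthodiag // => /esym; exact: nonincr_unique.
by split=> //; rewrite char_poly_orthodiag.
Qed.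

(** When X S = 0, X and S are the positive and negative parts of X + S.  Indeed
X p and S p are orthogonal, so |X p|^2 = c (p, X p) and |S p|^2 = c (p, S p); the
sign of c makes one of these nonpositive. *)
Lemma complementary_eigenvector X S (p : 'cV[R]_n) (c : R) :
  X^T = X -> S^T = S -> (forall u : 'cV[R]_n, 0 <= mxdot u (X *m u)) ->
  (forall u : 'cV[R]_n, mxdot u (S *m u) <= 0) -> X *m S = 0 ->
  (X + S) *m p = c *: p ->
  X *m p = Num.max c 0 *: p /\ S *m p = Num.min c 0 *: p.
Proof.
move=> Xt St Xp Sn XS; rewrite mulmxDl => E.
have qr : mxdot (X *m p) (S *m p) = 0.
  by rewrite mxdotMl Xt mulmxA XS mul0mx mxdot0r.
have qq : mxdot (X *m p) (X *m p) = c * mxdot p (X *m p).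
  have -> : c * mxdot p (X *m p) = mxdot (c *: p) (X *m p) by rewrite mxdotZl.
  by rewrite -E mxdotDl (mxdotC (S *m p)) qr addr0.
have rr : mxdot (S *m p) (S *m p) = c * mxdot p (S *m p).
  have -> : c * mxdot p (S *m p) = mxdot (c *: p) (S *m p) by rewrite mxdotZl.
  by rewrite -E mxdotDl qr add0r.
have [c0|c0] := leP c 0.
  have q0 : X *m p = 0.
    apply: mxdot_eq0; apply/eqP; rewrite eq_le mxdot_ge0 andbT qq.
    by rewrite mulr_le0_ge0.
  by rewrite scale0r q0; split=> //; rewrite -E q0 add0r.
have r0 : S *m p = 0.
  apply: mxdot_eq0; apply/eqP; rewrite eq_le mxdot_ge0 andbT rr.
  by rewrite mulr_ge0_le0 // ltW.
by rewrite scale0r r0; split=> //; rewrite -E r0 addr0.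
Qed.

(** A sorted diagonalization of X + S diagonalizes both matrices, and sortedness
survives c |-> max c 0 and c |-> min c 0. *)
Lemma simultaneous_orthodiag X S : psd X -> S^T = S ->
  (forall u : 'cV[R]_n, mxdot u (S *m u) <= 0) -> X *m S = 0 ->
  exists P, (orthodiag X `&` orthodiag S) P.
Proof.
move=> [/symmP Xt Xp] St Sn XS.
have Zt : (X + S)^T = X + S by rewrite linearD /= Xt St.
have [P [l [PP ls ZE]]] := symmetric_spectral Zt.
have PPt := mulmx1C PP.
have ZP : (X + S) *m P = P *m diag_mx l by rewrite ZE -mulmxA PP mulmx1.
have colE' (f : R -> R) (M : 'M[R]_n) : (forall i, M *m col i P = f (l 0 i) *: col i P) ->
    M = P *m diag_mx (map_mx f l) *m P^T.
  move=> H; have -> : M = M *m P *m P^T by rewrite -mulmxA PPt mulmx1.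
  congr (_ *m _); apply/matrixP => i j; rewrite mul_mx_diag !mxE mulrC.
  have /matrixP /(_ i 0) := H j; rewrite !mxE => <-.
  by apply: eq_bigr => k _; rewrite !mxE.
have ev i := @complementary_eigenvector X S (col i P) (l 0 i) Xt St Xp Sn XS.
have ZC i : (X + S) *m col i P = l 0 i *: col i P.
  apply/colP => k; have /matrixP /(_ k i) := ZP.
  rewrite mul_mx_diag !mxE mulrC => <-.
  by apply: eq_bigr => j _; rewrite !mxE.
have XE : X = P *m diag_mx (map_mx (Num.max^~ 0) l) *m P^T.
  by apply: colE' => i; exact: (ev i (ZC i)).1.
have SE : S = P *m diag_mx (map_mx (Num.min^~ 0) l) *m P^T.
  by apply: colE' => i; exact: (ev i (ZC i)).2.
exists P; split; split=> //.
  rewrite {2}XE eigvals_orthodiag // => i j ij; rewrite !mxE.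
  by rewrite ge_max !le_max lexx orbT ls.
rewrite {2}SE eigvals_orthodiag // => i j ij; rewrite !mxE.
by rewrite le_min !ge_min lexx orbT ls.
Qed.

End Eigenvalues.

(** * The two sets of directions *)

Section Upsilon.
Context {R : realType} {X : euclideanType R} {n : nat}.
Variables (B : X -> 'M[R]_n) (Xs Ss : 'M[R]_n).
Hypotheses (Xp : psd Xs) (St : Ss^T = Ss)
  (Sn : forall u : 'cV[R]_n, mxdot u (Ss *m u) <= 0) (XS : Xs *m Ss = 0).

Lemma subblock_eq0 (I J : {set 'I_n}) (M : 'M[R]_n) :
  subblock I J M = 0 <-> forall i j, i \in I -> j \in J -> M i j = 0.
Proof.
split=> [/matrixP H i j iI jJ|H].
  have := H (enum_rank_in iI i) (enum_rank_in jJ j).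
  by rewrite !mxE !enum_rankK_in.
by apply/matrixP => i j; rewrite !mxE H // enum_valP.
Qed.

Lemma eigvals_rayleigh (Z P : 'M[R]_n) i : orthodiag Z P ->
  eigvals Z 0 i = mxdot (col i P) (Z *m col i P).
Proof.
move=> [PP ZE]; rewrite [Z in RHS]ZE colE mxdotMl !mulmxA PP mul1mx.
rewrite -[_ *m P^T *m P]mulmxA PP mulmx1 mxdotE (bigD1 i) //= big_ord1.
rewrite big1 ?addr0 => [|j ij]; last by rewrite big_ord1 mxE (negbTE ij) mul0r.
by rewrite mul_diag_mx !mxE !eqxx mul1r mulr1.
Qed.

Lemma eigenindex_cases P : (orthodiag Xs `&` orthodiag Ss) P -> forall i,
  [\/ i \in alphaset Xs, i \in betaset Xs Ss | i \in gammaset Ss].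
Proof.
move=> [oX oS] i; have [_ Xp'] := Xp.
have x0 : 0 <= eigvals Xs 0 i by rewrite (eigvals_rayleigh _ oX).
have s0 : eigvals Ss 0 i <= 0 by rewrite (eigvals_rayleigh _ oS).
have [ai|ai] := boolP (i \in alphaset Xs); first by constructor 1.
have [gi|gi] := boolP (i \in gammaset Ss); first by constructor 3.
constructor 2; move: ai gi; rewrite !inE -!leNgt => x1 s1.
by rewrite !eq_le x0 x1 s0 s1.
Qed.

(** The columns outside gamma are killed by the zero eigenvalues of [Ss]. *)
Lemma gamma_columnsP P w : orthodiag Ss P ->
  B w *m Ss = 0 <-> forall i j, j \in gammaset Ss -> (P^T *m B w *m P) i j = 0.
Proof.
move=> [PP SE]; have PPt := mulmx1C PP.
have BS : P^T *m (B w *m Ss) *m P = P^T *m B w *m P *m diag_mx (eigvals Ss).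
  by rewrite {1}SE -!mulmxA PP mulmx1.
split=> [H i j|H].
  rewrite inE => sj; have /matrixP /(_ i j) := BS.
  rewrite H mulmx0 mul0mx mul_mx_diag !mxE => /esym /eqP.
  by rewrite mulf_eq0 (lt_eqF sj) orbF => /eqP.
have W0 : P^T *m B w *m P *m diag_mx (eigvals Ss) = 0.
  apply/matrixP => i j; rewrite mul_mx_diag [LHS]mxE [RHS]mxE.
  have [sj|sj] := boolP (j \in gammaset Ss); first by rewrite H ?mul0r.
  suff -> : eigvals Ss 0 j = 0 by rewrite mulr0.
  apply/eqP; rewrite eq_le; move: sj; rewrite inE -leNgt => ->; rewrite andbT.
  by rewrite (@eigvals_rayleigh _ P).
have : P *m (P^T *m (B w *m Ss) *m P) *m P^T = 0 by rewrite BS W0 mulmx0 mul0mx.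
by rewrite !mulmxA PPt mul1mx -mulmxA PPt mulmx1.
Qed.

Lemma identity_blkdiag P : (orthodiag Xs `&` orthodiag Ss) P ->
  blkdiag_ortho (eigblocks Xs Ss) (1%:M : 'M[R]_n).
Proof.
move=> oP; split=> [i j H|J _]; last first.
  have -> : subblock J J (1%:M : 'M[R]_n) = 1%:M.
    by apply/matrixP => i j; rewrite !mxE (inj_eq enum_val_inj).
  by rewrite /orthogonalmx /= trmx1 mulmx1.
rewrite mxE; case: eqVneq => // ij; case: H; rewrite -ij.
suff [J JB iJ] : exists2 J, J \in eigblocks Xs Ss & i \in J by exists J; rewrite ?iJ.
have blk (f : 'I_n -> R) (D : {set 'I_n}) : i \in D ->
    exists2 J, J \in preim_partition f D & i \in J.
  move=> iD; have := preim_partitionP f D => /and3P[/eqP cD _ _].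
  by move: iD; rewrite -{1}cD => /bigcupP[J]; exists J.
case: (eigenindex_cases oP i) => Hi.
- have [J JP iJ] := blk (eigvals Xs 0) _ Hi.
  by exists J => //; rewrite /eigblocks !inE JP.
- by exists (betaset Xs Ss) => //; rewrite /eigblocks !inE eqxx orbT.
- have [J JP iJ] := blk (eigvals Ss 0) _ Hi.
  by exists J => //; rewrite /eigblocks inE JP orbT.
Qed.

(** The row sets in the two vanishing conditions together cover all indices, and
gamma is contained in the column sets.  Conversely beta_+ = beta, with the other
parts of beta empty and gamma-tilde = gamma, imposes nothing else. *)
Lemma UpsilonP w : Upsilon B Xs Ss w <-> B w *m Ss = 0.
Proof.
split.
  case=> bm [bp [b0 [gt [P [Q [[gs _ _ [oX oS]] [bE _ W1 W2]]]]]]].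
  apply/(gamma_columnsP w oS) => i j jg; have jgt : j \in gt by exact: (fintype.subsetP gs _ jg).
  case: (eigenindex_cases (conj oX oS) i) => Hi.
  - by move/subblock_eq0 : W2; apply=> //; rewrite inE Hi.
  - move: Hi; rewrite bE !finset.in_setU -!orbA => /or4P[ib|ib|ib|].
    + by move/subblock_eq0 : W1; apply; rewrite !finset.in_setU ?ib ?jgt ?orbT.
    + by move/subblock_eq0 : W2; apply=> //; rewrite !finset.in_setU ib orbT.
    + by move/subblock_eq0 : W1; apply; rewrite !finset.in_setU ?ib ?jgt ?orbT.
    + rewrite finset.in_setD => /andP[_ ib].
      by move/subblock_eq0 : W1; apply; rewrite !finset.in_setU ?ib ?jgt ?orbT.
  - have ib : i \in gt by exact: (fintype.subsetP gs _ Hi).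
    by move/subblock_eq0 : W1; apply; rewrite !finset.in_setU ?ib ?jgt ?orbT.
move=> BS; have [P [oX oS]] := simultaneous_orthodiag Xp St Sn XS.
have W0 := (gamma_columnsP w oS).1 BS.
exists (finset.set0), (betaset Xs Ss), (finset.set0), (gammaset Ss), P, 1%:M.
rewrite mulmx1; split; split=> //.
- exact: (identity_blkdiag (conj oX oS)).
- by rewrite finset.set0U finset.setU0 finset.setDv finset.setU0.
- have e0 (i : 'I_#|@finset.set0 'I_n|) : False by case: i => k; rewrite cards0.
  split; first by apply/symmP/matrixP => i; case: (e0 i).
  by move=> u; rewrite mxdotE big1 // => i; case: (e0 i).
- by apply/subblock_eq0 => i j _; rewrite !inE => /orP[|sj]; [|apply: W0; rewrite inE].
- by apply/subblock_eq0 => i j _ jg; exact: W0.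
Qed.

Lemma Upsilon_starP w : Upsilon_star B Xs Ss w <-> B w *m Ss = 0.
Proof.
have ent P (I J : {set 'I_n}) :
    (subcols I P)^T *m B w *m subcols J P = subblock I J (P^T *m B w *m P).
  apply/matrixP => i j; rewrite !mxE; apply: eq_bigr => k _; rewrite !mxE; congr (_ * _).
  by apply: eq_bigr => k' _; rewrite !mxE.
split.
  case=> P oP; rewrite !tr_row_mx !mul_col_mx => /eqP.
  rewrite !col_mx_eq0 => /andP[/andP[/eqP Wa /eqP Wb] /eqP Wc].
  have [_ oS] := oP; apply/(gamma_columnsP w oS) => i j jg.
  rewrite !ent in Wa Wb Wc.
  by case: (eigenindex_cases oP i) => Hi; [move/subblock_eq0 : Wa|move/subblock_eq0 : Wb|move/subblock_eq0 : Wc]; apply.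
move=> BS; have [P oP] := simultaneous_orthodiag Xp St Sn XS; have [oX oS] := oP.
have W0 := (gamma_columnsP w oS).1 BS.
exists P => //; rewrite !tr_row_mx !mul_col_mx !ent.
have z (I : {set 'I_n}) : subblock I (gammaset Ss) (P^T *m B w *m P) = 0.
  by apply/subblock_eq0 => i j _ jg; exact: W0.
by rewrite !z !col_mx0.
Qed.

End Upsilon.

(** * A feasible second-order curve and its multiplier *)

Section SecondOrderCurve.
Context {R : realType} {n : nat}.
Variables (X S Y T M N W E Bp : 'M[R]_n) (eta : R).
Hypotheses (Xp : psd X) (XY : pseudo_inverse X Y) (ST : pseudo_inverse S T)
  (St : S^T = S) (Sn : forall u : 'cV[R]_n, mxdot u (S *m u) <= 0)
  (XS : X *m S = 0) (SX : S *m X = 0).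
Hypotheses (E_def : E = 1%:M - X *m Y) (Bp_def : Bp = E - S *m T).
Hypotheses (Mt : M^T = M) (Nt : N^T = N) (Wt : W^T = W) (eta0 : 0 < eta)
  (ME : E *m M *m E = Bp) (NE : E *m N *m E = E *m (M *m Y *m M) *m E + eta *: E)
  (WS : W *m S = 0)
  (Wsmall : forall u : 'cV[R]_n, `|mxdot u (W *m u)| <= mxdot u u / 2).

Lemma kernel_split : [/\ E *m S = S, S *m E = S & Bp^T = Bp] /\
  [/\ Bp *m Bp = Bp, Bp *m E = Bp & W *m Bp = W *m E].
Proof.
have [Et EE XE EX YE] := kernel_projectorP Xp XY; rewrite -E_def in Et EE XE EX YE.
have [Tt STC STS TST] := ST; have [Yt XYC XYX YXY] := XY.
have ES : E *m S = S by rewrite E_def mulmxBl mul1mx XYC -mulmxA XS mulmx0 subr0.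
have SE : S *m E = S by rewrite -{1}St -Et -trmx_mul ES St.
have Gt : (S *m T)^T = S *m T by rewrite trmx_mul Tt St STC.
have EG : E *m (S *m T) = S *m T by rewrite mulmxA ES.
have GE : S *m T *m E = S *m T by rewrite STC -mulmxA SE.
have GG : S *m T *m (S *m T) = S *m T by rewrite mulmxA STS.
rewrite Bp_def; split; split=> //.
- by rewrite linearB /= Et Gt.
- by rewrite mulmxBr !mulmxBl EE EG GE GG subrr subr0.
- by rewrite mulmxBl EE GE.
- by rewrite mulmxBr [W *m (S *m T)]mulmxA WS mul0mx subr0.
Qed.

(** On the kernel of [X] the first-order term is at least half of the beta
projector, and the choice of [N] leaves eta |e|^2 in the Schur complement.  The
perturbation [W] changes that complement only by products that contain Bp e,
because [W] vanishes on the range of [S]. *)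
Lemma curve_psd : exists2 s0 : R, 0 < s0 &
  forall s, 0 < s < s0 -> psd (X + s *: (M + W) + s ^+ 2 *: N).
Proof.
have [Et EE XE EX YE] := kernel_projectorP Xp XY; rewrite -E_def in Et EE XE EX YE.
have [[ES SE Bt] [BB BE WB]] := kernel_split; have [Yt XYC XYX YXY] := XY.
have [C1 C10 HC1] := mx_form_bound (W *m (Y *m M)).
have [C2 C20 HC2] := mx_form_bound (W *m (Y *m W)).
have EMe (e : 'cV[R]_n) : E *m e = e -> mxdot e (M *m e) = mxdot (Bp *m e) (Bp *m e).
  move=> Ee; rewrite -{1 2}Ee mxdotMl Et !mulmxA ME.
  by rewrite [RHS]mxdotMl Bt mulmxA BB.
have We (e : 'cV[R]_n) : E *m e = e -> W *m e = W *m (Bp *m e).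
  by move=> Ee; rewrite -{1}Ee mulmxA -WB -mulmxA.
apply: (@psd_perturbation _ _ X Y Xp XY (M + W) N Bp eta (2 * C1 + C2)) => //; rewrite -?E_def.
- by rewrite linearD /= Mt Wt.
- by rewrite addr_ge0 // ?mulr_ge0 // ltW.
- move=> e Ee; rewrite mulmxDl mxdotDr EMe //.
  have -> : mxdot e (W *m e) = mxdot (Bp *m e) (W *m (Bp *m e)).
    by rewrite We // mxdotMr Wt We // mxdotC.
  have := Wsmall (Bp *m e); rewrite ler_norml => /andP[]; lra.
- move=> e Ee.
  have eN : mxdot e (N *m e) = mxdot (M *m e) (Y *m (M *m e)) + eta * mxdot e e.
    have -> : mxdot e (N *m e) = mxdot e (E *m N *m E *m e).
      by rewrite -!mulmxA Ee [RHS]mxdotMr Et Ee.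
    rewrite NE mulmxDl mxdotDr -scalemxAl Ee mxdotZr; congr (_ + _).
    by rewrite -!mulmxA Ee [LHS]mxdotMr Et Ee [LHS]mxdotMr Mt.
  have h1 : mxdot (M *m e) (Y *m (W *m e)) = mxdot (Bp *m e) (W *m (Y *m M) *m e).
    rewrite mxdotMr Yt mxdotC We // mxdotMl Wt !mulmxA //.
  have h2 : mxdot (W *m e) (Y *m (M *m e)) = mxdot (Bp *m e) (W *m (Y *m M) *m e).
    by rewrite We // mxdotMl Wt !mulmxA.
  have h3 : mxdot (W *m e) (Y *m (W *m e)) = mxdot (Bp *m e) (W *m (Y *m W) *m e).
    by rewrite {1}We // mxdotMl Wt !mulmxA.
  rewrite eN mulmxDl mulmxDr !mxdotBE h1 h2 h3.
  have := HC1 (Bp *m e) e; rewrite ler_norml => /andP[_ +].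
  have := HC2 (Bp *m e) e; rewrite ler_norml => /andP[_ +].
  lra.
Qed.

Local Notation K := (Y *m M).
(** [S] transported by 1 - s Y M ([rotated_multiplierE]), which moves the range of
[S] so as to cancel, to first order, the block of s M between the range and the
kernel of [X].  The pairing of [S] itself with the curve would retain the term
s^2 tr (S M Y M) due to that block. *)
Definition rotated_multiplier (s : R) :=
  S - s *: (K *m S + S *m K^T) + s ^+ 2 *: (K *m S *m K^T).

Lemma rotated_multiplierE s :
  rotated_multiplier s = (1%:M - s *: K) *m S *m (1%:M - s *: K)^T.
Proof.
rewrite /rotated_multiplier; move: (Y *m M) => K.
have -> : (1%:M - s *: K)^T = 1%:M - s *: K^T by rewrite linearB linearZ /= trmx1.
rewrite mulmxBr mulmx1 !mulmxBl mul1mx -!scalemxAr -!scalemxAl scalerA -expr2.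
by rewrite scalerDr opprB opprD !addrA [LHS]addrAC.
Qed.

Lemma rotated_multiplier_nsd s :
  forall u : 'cV[R]_n, mxdot u (rotated_multiplier s *m u) <= 0.
Proof. by move=> u; rewrite rotated_multiplierE -!mulmxA mxdotMr. Qed.

(** Expanding in s, the terms of order 0 and 1 vanish because X S = 0 and [M], [W] are
orthogonal to [S]; in the term of order 2 the matrix M Y M occurs with the
coefficients 1 (from [N]), - 2 and 1 (from the rotation), which leaves eta tr S. *)
Lemma curve_complementarity : exists2 C : R, 0 <= C & forall s, 0 < s <= 1 ->
  - mxdot (rotated_multiplier s) (X + s *: (M + W) + s ^+ 2 *: N) <=
    s ^+ 2 * (eta * `|\tr S| + s * C).
Proof.
have [Et EE XE EX YE] := kernel_projectorP Xp XY; rewrite -E_def in Et EE XE EX YE.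
have [[ES SE Bt] [BB BE WB]] := kernel_split; have [Yt XYC XYX YXY] := XY.
have Xt := psd_sym Xp; have [Tt STC STS TST] := ST.
have Kt : K^T = M *m Y by rewrite trmx_mul Yt Mt.
have SW : S *m W = 0 by rewrite -Wt -{1}St -trmx_mul WS trmx0.
pose S1 := K *m S + S *m K^T; pose S2 := K *m S *m K^T.
have dS (U : 'M[R]_n) : mxdot S U = mxdot S (E *m U *m E).
  by rewrite mxdotC [RHS]mxdotC mxdot_mulmxr Et SE mxdotMl Et ES.
have dN : mxdot S N = mxdot S (M *m Y *m M) + eta * \tr S.
  rewrite (dS N) NE mxdotDr -dS mxdotZr; congr (_ + _ * _).
  by rewrite /mxdot St SE.
have SST : S *m (S *m T) = S by rewrite STC mulmxA STS.
have dM : mxdot S M = 0.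
  by rewrite dS ME Bp_def /mxdot St mulmxBr SE SST subrr mxtrace0.
have dX : mxdot S X = 0 by rewrite /mxdot St SX mxtrace0.
have dW : mxdot S W = 0 by rewrite /mxdot St SW mxtrace0.
have dl (U : 'M[R]_n) : mxdot S1 U = mxdot S (K^T *m U) + mxdot S (U *m K).
  by rewrite mxdotDl mxdotMl mxdot_mulmxr trmxK.
have S1X : mxdot S1 X = 0.
  rewrite dl [mxdot S (X *m _)]mxdotMr Xt XS mxdot0l addr0.
  by rewrite mxdotC mxdot_mulmxr Xt SX mxdot0r.
have S1W : mxdot S1 W = 0.
  rewrite dl [mxdot S (W *m _)]mxdotMr Wt WS mxdot0l addr0.
  by rewrite mxdotC mxdot_mulmxr Wt SW mxdot0r.
have S1M : mxdot S1 M = 2 * mxdot S (M *m Y *m M).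
  by rewrite dl Kt mulmxA; ring.
have S2X : mxdot S2 X = mxdot S (M *m Y *m M).
  rewrite /S2 mxdot_mulmxr trmxK mxdotMl Kt; congr (mxdot S _).
  by rewrite -[in RHS]YXY !mulmxA.
exists (`|mxdot S1 N| + `|mxdot S2 (M + W)| + `|mxdot S2 N|) => [|s /andP[s0 s1]].
  by rewrite !addr_ge0.
have -> : mxdot (rotated_multiplier s) (X + s *: (M + W) + s ^+ 2 *: N) =
    s ^+ 2 * (eta * \tr S + s * (mxdot S2 (M + W) - mxdot S1 N + s * mxdot S2 N)).
  rewrite /rotated_multiplier -/S1 -/S2; move: dl S1X S1W S1M S2X.
  move: (S1) (S2) => U1 U2 _ S1X S1W S1M S2X.
  rewrite !mxdotBE dX dM dW dN S1X S1W S1M S2X; ring.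
have s0' := ltW s0.
rewrite -mulrN ler_wpM2l ?sqr_ge0 //.
have h1 : - (eta * \tr S) <= eta * `|\tr S|.
  by rewrite -mulrN ler_wpM2l ?(ltW eta0) // -normrN ler_norm.
have h2 : - (mxdot S2 (M + W) - mxdot S1 N + s * mxdot S2 N) <=
    `|mxdot S1 N| + `|mxdot S2 (M + W)| + `|mxdot S2 N|.
  have g1 : s * `|mxdot S2 N| <= `|mxdot S2 N| by rewrite ler_piMl.
  have g2 : - (s * mxdot S2 N) <= s * `|mxdot S2 N|.
    by rewrite -mulrN ler_wpM2l // -normrN ler_norm.
  have g3 := ler_norm (mxdot S1 N).
  have g4 : - mxdot S2 (M + W) <= `|mxdot S2 (M + W)| by rewrite -normrN ler_norm.
  lra.
have := ler_wpM2l s0' h2; lra.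
Qed.

End SecondOrderCurve.

(** * Tilt stability excludes flat directions *)

Section FlatDirection.
Context {R : realType} {X : euclideanType R} {m n : nat}.
Variables (A : {linear X -> 'cV[R]_m}) (b : 'cV[R]_m)
  (B : {linear X -> 'M[R]_n}) (B0 : 'M[R]_n).
Hypothesis (Bsym : forall x, symm (B x)).
Variables (phi : X -> \bar R) (O : set X).
Hypotheses (phiNy : forall x, phi x != -oo%E) (O_open : open O)
  (O_feasible : feasible A b B B0 `<=` O)
  (phi_fin : forall x, O x -> phi x \is a fin_num)
  (phi_C2 : twice_cont_diff_on O (fine \o phi)).
Variables (xs : X) (ys : 'cV[R]_m) (Ss : 'M[R]_n).
Hypotheses (feas : feasible A b B B0 xs) (NS : normal_psd (gmap B B0 xs) Ss)
  (KKT : adj A ys + adj B Ss = - grad (fine \o phi) xs)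
  (ND : Sp (normal_psd (gmap B B0 xs)) `&` adj B @^-1` range (adj A) = [set 0]).

Lemma gmapD x h : gmap B B0 (x + h) = gmap B B0 x + B h.
Proof. by rewrite /gmap raddfD addrAC. Qed.

Lemma psdZ k (c : R) (M : 'M[R]_k) : 0 <= c -> psd M -> psd (c *: M).
Proof.
move=> c0 [/symmP Mt Mp]; split; first by apply/symmP; rewrite linearZ /= Mt.
by move=> u; rewrite -scalemxAl mxdotZr mulr_ge0.
Qed.

Lemma feasible_convex x y (c : R) : 0 <= c <= 1 ->
  feasible A b B B0 x -> feasible A b B B0 y -> feasible A b B B0 (x + c *: (y - x)).
Proof.
move=> /andP[c0 c1] [Ax gx] [Ay gy]; split => /=.
  by rewrite linearD linearZ linearB /= Ax Ay subrr scaler0 addr0.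
have -> : gmap B B0 (x + c *: (y - x)) = (1 - c) *: gmap B B0 x + c *: gmap B B0 y.
  have -> : gmap B B0 y = gmap B B0 x + B (y - x) by rewrite -gmapD addrC subrK.
  rewrite gmapD [B (c *: _)]linearZ /=; move: (gmap B B0 x) (B (y - x)) => U V.
  by rewrite scalerDr addrA -scalerDl subrK scale1r.
by apply: psdD; apply: psdZ => //; rewrite subr_ge0.
Qed.

Lemma exists_small (l : seq R) : all (fun c => 0 < c) l ->
  exists2 s : R, 0 < s & all (fun c => s < c) l.
Proof.
elim: l => [_|c l IH /= /andP[c0 /IH [s s0 sl]]]; first by exists 1.
exists (Num.min s (c / 2)); first by rewrite lt_min s0 divr_gt0.
rewrite gt_min ltr_pdivrMr // ltr_pMr // ltr1n orbT /=.
by apply: sub_all sl => c' sc'; rewrite gt_min sc'.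
Qed.

(** The points pt 0 s and pt w1 s of the two curves share the multiplier nu s, so
their tilts differ by o(s); this contradicts the Lipschitz estimate, because the
points differ by s |w1|. *)
Lemma tilt_stable_no_flat_direction w :
  tilt_stable (fun x => phi x + indicator (feasible A b B B0) x)%E xs ->
  hess (fine \o phi) xs w = 0 -> A w = 0 -> B w *m Ss = 0 -> w = 0.
Proof.
set D := feasible A b B B0; set F := fine \o phi.
move=> tilt Hw Aw BwS; apply/eqP/negPn/negP => w0.
have Oxs : O xs := O_feasible feas.
have [C [r [C0 r0 Htilt]]] := tilt_stable_approx_stationary phiNy O_open O_feasible
  phi_fin phi_C2 feas feasible_convex tilt.
have [Axs Xp] := feas.
have [St Sn XS SX] := normal_psdP Xp NS.
have [Y XY] := pseudo_inverse_ex (psd_sym Xp).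
have [T ST] := pseudo_inverse_ex St.
have Bt h : (B h)^T = B h by apply/symmP.
have onto M0 := nondegenerate_onto (M0 := M0) Bsym feas XY ND.
have [Xs Xs_def] : exists Xs, Xs = gmap B B0 xs by exists (gmap B B0 xs).
rewrite /= -Xs_def in Xp XS SX XY onto.
have [E E_def] : exists E, E = 1%:M - Xs *m Y by exists (1%:M - Xs *m Y).
have [Bp Bp_def] : exists Bp, Bp = E - Ss *m T by exists (E - Ss *m T).
have [Et EE XE EX YE] := kernel_projectorP Xp XY.
rewrite -E_def in Et EE XE EX YE onto.
pose small (v : X) := forall u : 'cV[R]_n, `|mxdot u (B v *m u)| <= mxdot u u / 2.
(* Scaling w makes the beta block of B w1 at most 1/2, so that adding it to
   the identity keeps the beta block of B d + B w1 positive definite. *)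
have [w1 [w10 Hw1 Aw1 BwS1 Wsm]] : exists w1,
    [/\ w1 != 0, hess F xs w1 = 0, A w1 = 0, B w1 *m Ss = 0 & small w1].
  have [c c0 Hc] := mx_form_bound (B w).
  have c2 : 0 < (2 * c)^-1 by rewrite invr_gt0 mulr_gt0.
  exists ((2 * c)^-1 *: w); split.
  - by rewrite scaler_eq0 negb_or gt_eqF.
  - by rewrite hessZ Hw scaler0.
  - by rewrite linearZ /= Aw scaler0.
  - by rewrite linearZ /= -scalemxAl BwS scaler0.
  - move=> u; rewrite linearZ /= -scalemxAl mxdotZr normrM gtr0_norm //.
    rewrite ler_pdivrMl ?mulr_gt0 //; apply: le_trans (Hc u u) _.
    rewrite -mulrA -expr2 mxnorm_sqr.
    by rewrite [2 * c]mulrC -mulrA [2 * _]mulrC divfK // pnatr_eq0.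
have w1p : 0 < `|w1| by rewrite normr_gt0.
(* The gradient gap and the normality error are each allowed a quarter of
   s |w1| / C, so the Lipschitz estimate bounds s |w1| by half of itself. *)
have [k0 k0p k0_def] : exists2 k0, 0 < k0 & 4 * C * k0 = `|w1|.
  by exists (`|w1| / (4 * C)); rewrite ?divr_gt0 ?mulr_gt0 // mulrC divfK // gt_eqF // mulr_gt0.
have tp : 0 < 2 * (`|\tr Ss| + 1) by rewrite mulr_gt0 // ltr_wpDl.
have [eta etap eta_def] : exists2 eta, 0 < eta & k0 ^+ 2 = eta * (2 * (`|\tr Ss| + 1)).
  by exists (k0 ^+ 2 / (2 * (`|\tr Ss| + 1))); rewrite ?divr_gt0 ?exprn_gt0 // divfK // gt_eqF.
have [[ES SE Bpt] [BpBp BpE _]] := kernel_split Xp XY ST St XS E_def Bp_def (mul0mx _ Ss).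
have EBp : E *m Bp = Bp by rewrite -[in LHS]Bpt -{1}Et -trmx_mul BpE Bpt.
(* Bp is the projector onto the beta space, the orthogonal complement of the
   range of Ss in the kernel of Xs. *)
have [d [Ad Md]] : exists d, A d = 0 /\ E *m B d *m E = Bp.
  by apply: onto => //; rewrite EBp BpE.
set M := B d in Md; have Mt : M^T = M by exact: Bt.
have [Yt _ _ _] := XY.
have [e [Ae Ne]] : exists e, A e = 0 /\
    E *m B e *m E = E *m (M *m Y *m M) *m E + eta *: E.
  apply: onto.
    by rewrite linearD linearZ /= !trmx_mul Et Yt Mt !mulmxA.
  rewrite mulmxDr mulmxDl -scalemxAr -scalemxAl EE EE !mulmxA EE.
  by rewrite -!mulmxA EE.
set N := B e in Ne; have Nt : N^T = N by exact: Bt.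
pose Sr s := rotated_multiplier Ss Y M s.
pose pt (v : X) (s : R) := xs + s *: (d + v) + s ^+ 2 *: e.
have gpt v s : gmap B B0 (pt v s) = Xs + s *: (M + B v) + s ^+ 2 *: N.
  by rewrite /pt !gmapD -Xs_def [B (s *: _)]linearZ [B (_ ^+ 2 *: _)]linearZ [B (d + v)]linearD.
have ptA v s : A v = 0 -> A (pt v s) = b.
  move=> Av; rewrite /pt [A (_ + _ + _)]linearD [A (xs + _)]linearD /=.
  rewrite [A (s *: _)]linearZ [A (_ ^+ 2 *: _)]linearZ [A (d + v)]linearD /= Ad Ae Av.
  by rewrite addr0 !scaler0 !addr0; exact: Axs.
pose nu s := adj A ys + adj B (Sr s).
have [K [rg [K_gt0 rg_gt0 Klip]]] := grad_lipschitz O_open phi_C2 Oxs.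
have [rf rf_gt0 flat] := grad_flat O_open phi_C2 Oxs k0p Hw1.
pose dist0 := `|d| + `|w1| + `|e| + 1.
have dist0p : 0 < dist0 by rewrite ltr_wpDl // !addr_ge0.
have ptxs v s : `|v| <= `|w1| -> 0 < s <= 1 -> `|pt v s - xs| <= s * dist0.
  move=> vw /andP[s0 s1]; rewrite /pt -[xs + _ + _]addrA [xs + _]addrC addrK.
  apply: le_trans (ler_normD _ _) _; rewrite !normrZ !gtr0_norm ?exprn_gt0 //.
  have h1 : s * `|d + v| <= s * (`|d| + `|w1|).
    by rewrite ler_pM2l // (le_trans (ler_normD _ _)) // lerD2l.
  have h2 : s ^+ 2 * `|e| <= s * `|e| by rewrite ler_wpM2r // expr2 ler_piMr // ltW.
  by rewrite /dist0; lra.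
pose S1 := Y *m M *m Ss + Ss *m (Y *m M)^T; pose S2 := Y *m M *m Ss *m (Y *m M)^T.
have nuE s : nu s + grad F xs = (- s) *: adj B S1 + s ^+ 2 *: adj B S2.
  rewrite /nu.
  have -> : grad F xs = - (adj A ys + adj B Ss) by rewrite KKT opprK.
  have -> : Sr s = Ss + (- s) *: S1 + s ^+ 2 *: S2 by rewrite scaleNr.
  rewrite (adjD B (Ss + _)) (adjD B Ss) !adjZ; move: (adj A ys) (adj B Ss) => a c.
  by rewrite opprD addrACA subrr add0r -[c + _ + _]addrA addrC addKr.
have nu_small s : 0 < s <= 1 -> `|nu s + grad F xs| <= s * (`|adj B S1| + `|adj B S2|).
  move=> /andP[s0 s1]; rewrite nuE; apply: le_trans (ler_normD _ _) _.
  rewrite !normrZ normrN !gtr0_norm ?exprn_gt0 // mulrDr lerD2l.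
  by rewrite ler_wpM2r // ler_piMr // ltW.
(* The pairing of the multiplier with z - x is at most minus its pairing with
   g x, since g z is positive semidefinite. *)
have normal v s c z : A v = 0 -> 0 < s <= 1 -> D z ->
    - mxdot (Sr s) (Xs + s *: (M + B v) + s ^+ 2 *: N) <= c ->
    inner (nu s) (z - pt v s) <= c.
  move=> Av s01 [Az gz]; apply: le_trans.
  rewrite innerDl !adjE -gpt.
  have -> : A (z - pt v s) = 0 by rewrite linearB /= ptA // (Az : A z = b) subrr.
  have -> : B (z - pt v s) = gmap B B0 z - gmap B B0 (pt v s).
    by rewrite linearB /= /gmap opprB addrA subrK.
  rewrite mxdot0r add0r mxdotDr mxdotNr gerDr.
  exact: mxdot_nsd_psd_le0 (rotated_multiplier_nsd Y M Sn s) gz.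
have B0w : B 0 *m Ss = 0 by rewrite linear0 mul0mx.
have small0 : small 0.
  by move=> u; rewrite linear0 mul0mx mxdot0r normr0 divr_ge0 // mxdot_ge0.
have [sA sA0 psdA] := curve_psd Xp XY ST St XS E_def Bp_def Mt Nt (Bt 0) etap Md Ne B0w small0.
have [sB sB0 psdB] := curve_psd Xp XY ST St XS E_def Bp_def Mt Nt (Bt w1) etap Md Ne BwS1 Wsm.
have [CA CA0 compA] := curve_complementarity Xp XY ST St XS SX E_def Bp_def Mt (Bt 0) etap Md Ne B0w.
have [CB CB0 compB] := curve_complementarity Xp XY ST St XS SX E_def Bp_def Mt (Bt w1) etap Md Ne BwS1.
pose nK := K * dist0 + `|adj B S1| + `|adj B S2| + 1.
have nKp : 0 < nK by rewrite ltr_wpDl // !addr_ge0 // mulr_ge0 // ltW.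
have CA1 : 0 < CA + 1 by rewrite ltr_wpDl.
have CB1 : 0 < CB + 1 by rewrite ltr_wpDl.
have [|s s0] := @exists_small [:: 1; sA; sB; k0^-1; r / dist0; rg / dist0; rf / dist0; r / nK;
  eta / (CA + 1); eta / (CB + 1)].
  by rewrite /= ltr01 sA0 sB0 invr_gt0 k0p (divr_gt0 r0) // (divr_gt0 rg_gt0) //
    (divr_gt0 rf_gt0) // (divr_gt0 r0 nKp) (divr_gt0 etap) // (divr_gt0 etap).
rewrite /= andbT => /and5P[s1 sA1 sB1 sk /and5P[sr srg srf snK /andP[sCA sCB]]].
rewrite !ltr_pdivlMr // in sr srg srf snK sCA sCB.
have s01 : 0 < s <= 1 by rewrite s0 ltW.
have k01 : 0 < s * k0 <= 1.
  by rewrite mulr_gt0 //= -ler_pdivlMr // mul1r ltW.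
have comp_small c : 0 <= c -> s * (c + 1) < eta ->
    s ^+ 2 * (eta * `|\tr Ss| + s * c) <= (s * k0) ^+ 2.
  move=> c0 sc; rewrite exprMn ler_wpM2l ?sqr_ge0 //.
  have : 0 <= eta * `|\tr Ss| by rewrite mulr_ge0 // ltW.
  by move: sc eta_def; lra.
have key v : `|v| <= `|w1| -> A v = 0 -> psd (Xs + s *: (M + B v) + s ^+ 2 *: N) ->
    - mxdot (Sr s) (Xs + s *: (M + B v) + s ^+ 2 *: N) <= (s * k0) ^+ 2 ->
    [/\ D (pt v s), `|pt v s - xs| < r, `|grad F (pt v s) + nu s| < r &
      forall z, D z -> inner (grad F (pt v s) + nu s - grad F (pt v s)) (z - pt v s)
        <= (s * k0) ^+ 2].
  move=> vw Av pv cv; have near := ptxs v s vw s01; split.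
  - by split=> /=; [exact: ptA|rewrite gpt].
  - exact: le_lt_trans near sr.
  - have -> : grad F (pt v s) + nu s = (grad F (pt v s) - grad F xs) + (nu s + grad F xs).
      by rewrite [nu s + _]addrC subrKA.
    apply: le_lt_trans (ler_normD _ _) _.
    have h1 := nu_small s s01.
    have h2 : `|grad F (pt v s) - grad F xs| <= K * (s * dist0).
      apply: le_trans (Klip xs (pt v s) _ _) _; rewrite ?subrr ?normr0 //.
        exact: le_lt_trans near srg.
      by rewrite ler_pM2l.
    move: snK; rewrite /nK => snK; lra.
  - by move=> z Dz; rewrite addrAC subrr add0r; exact: normal.
have w1le : `|w1| <= `|w1| by [].
have zle : `|0 : X| <= `|w1| by rewrite normr0.
have sAin : 0 < s < sA by rewrite s0.
have sBin : 0 < s < sB by rewrite s0.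
have p0 := key 0 zle (linear0 A) (psdA s sAin) (le_trans (compA s s01) (comp_small CA CA0 sCA)).
have p1 := key w1 w1le Aw1 (psdB s sBin) (le_trans (compB s s01) (comp_small CB CB0 sCB)).
have ptE : pt w1 s = pt 0 s + s *: w1.
  by rewrite /pt addr0 [s *: (d + w1)]scalerDr addrA [LHS]addrAC.
have := Htilt (s * k0) (pt w1 s) (pt 0 s) (grad F (pt w1 s) + nu s) (grad F (pt 0 s) + nu s) k01.
have H x v : (x, v) = (pt w1 s, grad F (pt w1 s) + nu s) \/
    (x, v) = (pt 0 s, grad F (pt 0 s) + nu s) ->
    [/\ D x, `|x - xs| < r, `|v| < r & forall z, D z -> inner (v - grad F x) (z - x) <= (s * k0) ^+ 2].
  by case=> -[-> ->].
move=> /(_ H).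
have -> : grad F (pt w1 s) + nu s - (grad F (pt 0 s) + nu s) =
    grad F (pt w1 s) - grad F (pt 0 s) by rewrite opprD addrACA subrr addr0.
have h0 := ptxs 0 s zle s01; have h1 := ptxs w1 s w1le s01.
have hflat : `|grad F (pt w1 s) - grad F (pt 0 s)| <= s * k0.
  rewrite ptE; apply: flat; rewrite ?(ltW s0) //; first exact: le_lt_trans h0 srf.
  by rewrite -ptE; exact: le_lt_trans h1 srf.
rewrite ptE [pt 0 s + _]addrC addrK normrZ gtr0_norm // -k0_def => Hfin.
have : C * (`|grad F (s *: w1 + pt 0 s) - grad F (pt 0 s)| + s * k0) <= C * (s * k0 + s * k0).
  by rewrite ler_pM2l // lerD2r [s *: w1 + _]addrC -ptE.
have : 0 < s * (C * k0) by rewrite !mulr_gt0.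
lra.
Qed.

End FlatDirection.

(** Under the inclusion, each normal matrix S has adj B S = adj A y for some y, and
[regular_multiplier_zero] makes S zero: the cone itself is trivial. *)
Lemma regular_nondegenerate (R : realType) (X : euclideanType R) (m n : nat)
  (A : {linear X -> 'cV[R]_m}) (b : 'cV[R]_m) (B : {linear X -> 'M[R]_n}) (B0 : 'M[R]_n)
  (xs : X) : feasible A b B B0 xs -> Gmap_metrically_regular A b B B0 xs ->
  adj B @` Sp (normal_psd (gmap B B0 xs)) `<=` range (adj A) ->
  Sp (normal_psd (gmap B B0 xs)) `&` adj B @^-1` range (adj A) = [set 0].
Proof.
move=> feas reg sub; set N := normal_psd _.
have N0 : N 0.
  by apply: normal_psdI => [|u|]; rewrite ?trmx0 ?mul0mx ?mxdot0r.
have Nz S : N S -> S = 0.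
  move=> NS; have SpS : Sp N S by exists 1, S, 0; split=> //; rewrite subr0 scale1r.
  have [y _ yE] : range (adj A) (adj B S) by apply: sub; exists S.
  apply: (regular_multiplier_zero feas reg (y := - y) NS).
  by rewrite -scaleN1r adjZ yE scaleN1r addNr.
apply/seteqP; split=> [M [[t [u [v [_ /Nz -> /Nz -> ->]]]] _]|_ ->] /=.
  by rewrite subrr scaler0.
split; first by exists 1, 0, 0; split=> //; rewrite subrr scaler0.
by exists 0 => //; apply: inner_inj => h; rewrite !adjE !mxdot0l.
Qed.

Theorem theorem3p4 (R : realType) (X : euclideanType R) (m n : nat)
  (A : {linear X -> 'cV[R]_m}) (b : 'cV[R]_m)
  (B : {linear X -> 'M[R]_n}) (B0 : 'M[R]_n)
  (Bsym : forall x, symm (B x)) (B0sym : symm B0)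
  (phi : X -> \bar R) (O : set X)
  (phi_proper : proper_fun phi) (phi_lsc : lower_semicontinuous phi)
  (O_open : open O) (O_feasible : feasible A b B B0 `<=` O)
  (phi_fin : forall x, O x -> phi x \is a fin_num)
  (phi_C2 : twice_cont_diff_on O (fine \o phi))
  (xs : X) (xs_opt : local_optimal A b B B0 phi xs)
  (G_regular : Gmap_metrically_regular A b B B0 xs)
  (ys : 'cV[R]_m) (Ss : 'M[R]_n) :
  let vs := - grad (fine \o phi) xs in
  let Xs := gmap B B0 xs in
  let Ks := tangent_psd Xs `&` Sp (normal_psd (- Ss)) in
  let NX := Sp (normal_psd Xs) in
  let KerH := hess (fine \o phi) xs @^-1` [set 0] in
  let KerA := A @^-1` [set 0] in
  multipliers A b B B0 xs vs (ys, Ss) ->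
  Ks `<=` range B ->
  set_inj (B @^-1` Ks) B ->
  (NX `&` adj B @^-1` range (adj A) = [set 0] \/
   adj B @` NX `<=` range (adj A)) ->
  (KerH `&` KerA `&` Upsilon B Xs Ss = [set 0] <->
   KerH `&` KerA `&` Upsilon_star B Xs Ss = [set 0]) /\
  (tilt_stable (fun x => phi x + indicator (feasible A b B B0) x)%E xs ->
   KerH `&` KerA `&` Upsilon B Xs Ss = [set 0]).

Proof.
move=> vs Xs Ks NX KerH KerA [_ NS KKT] _ _ AB.
have feas : feasible A b B B0 xs by case: xs_opt.
have [_ Xp] := feas; have [St Sn XS _] := normal_psdP Xp NS.
have UP := UpsilonP B Xp St Sn XS; have UsP := Upsilon_starP B Xp St Sn XS.
have -> : Upsilon_star B Xs Ss = Upsilon B Xs Ss.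
  by apply/seteqP; split=> w; [move/UsP/UP|move/UP/UsP].
split=> // tilt; apply/seteqP; split=> [w [[Hw Aw] /UP BwS]|_ ->].
  have ND : NX `&` adj B @^-1` range (adj A) = [set 0].
    by case: AB => // /(regular_nondegenerate feas G_regular).
  exact: (tilt_stable_no_flat_direction Bsym phi_proper.1 O_open O_feasible phi_fin
    phi_C2 feas NS KKT ND tilt).
split; first by split; [exact: linear0|exact: linear0].
by apply/UP; rewrite linear0 mul0mx.
Qed.
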